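(* The search problem Injective Categorized Pigeon is $\mathsf{PPADS}$-hard.
   Context: Injective Categorized Pigeon: given Boolean circuits $p:\{0,1\}^{m_1+m_2}\to\{0,1\}^{m_1}$, $h:\{0,1\}^{m_1+m_2}\to\{0,1\}^{m_2}$ and a list of $k<2^{m_1}$ removed elements $\Pi=\{\pi_1,\dots,\pi_k\}\subseteq\{0,1\}^{m_1+m_2}$ such that $h(\pi_i)\neq h(\pi_j)$ for all distinct $\pi_i,\pi_j\in\Pi$, find either (1) $x\in\{0,1\}^{m_1+m_2}\setminus\Pi$ with $h(x)\in h(\Pi)$, or (2) two distinct $x,y\in\{0,1\}^{m_1+m_2}\setminus\Pi$ with $p(x)=p(y)$ and $h(x)=h(y)$. Sink of Line: given Boolean circuits $S,P:\{0,1\}^n\to\{0,1\}^n$ and $s\in\{0,1\}^n$ with $P(s)=s\neq S(s)$, find $x\in\{0,1\}^n$ with $P(S(x))\neq x$. $\mathsf{PPADS}$ is the class of search problems polynomial-time reducible to Sink of Line (a reduction from $R$ to $S'$ being polynomial-time computable $f,g$ such that whenever $y$ solves $S'$ on $f(x)$, $g(x,y)$ solves $R$ on $x$). A problem is $\mathsf{PPADS}$-hard if every problem in $\mathsf{PPADS}$ reduces to it. *)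

(* Defs.v *)
From HB Require Import structures.
From mathcomp Require Import all_boot.

Set Implicit Arguments.
Unset Strict Implicit.
Unset Printing Implicit Defensive.

Definition word := seq bool.

(* Deterministic multi-tape Turing machines.  [None] is the blank symbol; a
   machine has [extra_tapes.+2] tapes, all read-write and infinite in both
   directions. *)

Definition symbol := option bool.

Inductive move := MoveLeft | Stay | MoveRight.

Record machine := Machine {
  extra_tapes : nat;
  state : finType;
  start : state;
  halting : pred state;
  transition : state -> {ffun 'I_extra_tapes.+2 -> symbol} ->
               state * ('I_extra_tapes.+2 -> symbol * move)
}.

(* [(l, r)]: [r] is read from the scanned cell rightwards and [l] from the cell
   on its left leftwards; cells that are not listed are blank. *)
Definition tape := (seq symbol * seq symbol)%type.

Definition scanned (t : tape) : symbol := head None t.2.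

Definition write_move (a : symbol * move) (t : tape) : tape :=
  let: (l, r) := (t.1, behead t.2) in
  match a.2 with
  | MoveLeft => (behead l, [:: head None l, a.1 & r])
  | Stay => (l, a.1 :: r)
  | MoveRight => (a.1 :: l, r)
  end.

Definition config (M : machine) :=
  (state M * {ffun 'I_(extra_tapes M).+2 -> tape})%type.

Definition step (M : machine) (c : config M) : config M :=
  if halting c.1 then c else
  let: (q, act) := transition c.1 [ffun i => scanned (c.2 i)] in
  (q, [ffun i => write_move (act i) (c.2 i)]).

Definition initial (M : machine) (inputs : seq word) : config M :=
  (start M, [ffun i => ([::], map Some (nth [::] inputs (nat_of_ord i)))]).

Fixpoint blank_free_prefix (s : seq symbol) : word :=
  if s is Some b :: s' then b :: blank_free_prefix s' else [::].

(* The output is the word on tape 0 that starts at the head and stops before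
   the first blank. *)
Definition computes_within (M : machine) (inputs : seq word) (out : word)
    (t : nat) : Prop :=
  let c := iter t (@step M) (initial M inputs) in
  halting c.1 /\ blank_free_prefix (c.2 ord0).2 = out.

Definition polytime1 (f : word -> word) : Prop :=
  exists (M : machine) (a d : nat), forall x,
    computes_within M [:: x] (f x) (a * size x ^ d + a).

Definition polytime2 (g : word -> word -> word) : Prop :=
  exists (M : machine) (a d : nat), forall x y,
    computes_within M [:: x; y] (g x y) (a * (size x + size y) ^ d + a).

(* [solution R x y] is meaningful only when [x] is an instance of [R]. *)
Record search_problem := SearchProblem {
  instance : word -> Prop;
  solution : word -> word -> Prop
}.

Definition reduces_to (R Q : search_problem) : Prop :=
  exists (f : word -> word) (g : word -> word -> word),
    [/\ polytime1 f, polytime2 g &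
        forall x, instance R x ->
          instance Q (f x) /\
          forall y, solution Q (f x) y -> solution R x (g x y)].

(* In a circuit with n inputs, wires 0, ..., n - 1 are the inputs and wire
   n + j is the output of the j-th gate. *)

Inductive gate :=
| Const of bool
| Not of nat
| And of nat & nat
| Or of nat & nat.

(* The arguments of [g] are among the first [w] wires. *)
Definition gate_ok (w : nat) (g : gate) : bool :=
  match g with
  | Const _ => true
  | Not i => i < w
  | And i j | Or i j => (i < w) && (j < w)
  end.

Fixpoint gates_ok (w : nat) (gs : seq gate) : bool :=
  if gs is g :: gs' then gate_ok w g && gates_ok w.+1 gs' else true.

Record circuit (n m : nat) := Circuit {
  gates : seq gate;
  outputs : m.-tuple nat;
  gates_wf : gates_ok n gates;
  outputs_wf : all (fun i => i < n + size gates) outputs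
}.

Definition gate_value (v : seq bool) (g : gate) : bool :=
  match g with
  | Const b => b
  | Not i => ~~ nth false v i
  | And i j => nth false v i && nth false v j
  | Or i j => nth false v i || nth false v j
  end.

Definition wire_values (v : seq bool) (gs : seq gate) : seq bool :=
  foldl (fun v' g => rcons v' (gate_value v' g)) v gs.

Definition eval_circuit (n m : nat) (C : circuit n m) (x : n.-tuple bool) :
    m.-tuple bool :=
  [tuple of map (nth false (wire_values x (gates C))) (outputs C)].

Coercion eval_circuit : circuit >-> Funclass.

(* Self-delimiting binary encodings.  Numbers are in unary: they are numbers of
   inputs and outputs and wire names, so this changes the length of an instance
   only polynomially. *)

Definition enc_nat (n : nat) : word := rcons (nseq n true) false.

Definition enc_seq (T : Type) (enc : T -> word) (s : seq T) : word :=
  rcons (flatten [seq true :: enc a | a <- s]) false.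

Definition enc_bits : seq bool -> word := enc_seq (fun b => [:: b]).

Definition enc_gate (g : gate) : word :=
  match g with
  | Const b => [:: false; false; b]
  | Not i => [:: false; true] ++ enc_nat i
  | And i j => [:: true; false] ++ enc_nat i ++ enc_nat j
  | Or i j => [:: true; true] ++ enc_nat i ++ enc_nat j
  end.

Definition enc_circuit (n m : nat) (C : circuit n m) : word :=
  enc_seq enc_gate (gates C) ++ enc_seq enc_nat (outputs C).

Record sol_input := SolInput {
  sol_n : nat;
  sol_S : circuit sol_n sol_n;
  sol_P : circuit sol_n sol_n;
  sol_s : sol_n.-tuple bool;
  sol_source : sol_P sol_s = sol_s /\ sol_s <> sol_S sol_s
}.

Definition enc_sol_input (I : sol_input) : word :=
  enc_nat (sol_n I) ++ enc_circuit (sol_S I) ++ enc_circuit (sol_P I)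
  ++ enc_bits (sol_s I).

Definition SinkOfLine : search_problem := {|
  instance w := exists I : sol_input, w = enc_sol_input I;
  solution w z := exists (I : sol_input) (x : (sol_n I).-tuple bool),
    [/\ w = enc_sol_input I, z = x & sol_P I (sol_S I x) <> x]
|}.

(* At least one element is removed: for an empty Pi the problem would not be
   total (x |-> (p x, h x) may be a bijection), and any problem would reduce to
   such an instance without solutions. *)
Record icp_input := IcpInput {
  icp_m1 : nat;
  icp_m2 : nat;
  icp_p : circuit (icp_m1 + icp_m2) icp_m1;
  icp_h : circuit (icp_m1 + icp_m2) icp_m2;
  icp_Pi : seq ((icp_m1 + icp_m2).-tuple bool);
  icp_Pi_uniq : uniq icp_Pi;
  icp_Pi_size : 0 < size icp_Pi < 2 ^ icp_m1;
  icp_h_inj : {in icp_Pi &, injective icp_h}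
}.

Definition enc_icp_input (I : icp_input) : word :=
  enc_nat (icp_m1 I) ++ enc_nat (icp_m2 I)
  ++ enc_circuit (icp_p I) ++ enc_circuit (icp_h I)
  ++ enc_seq (fun x : (icp_m1 I + icp_m2 I).-tuple bool => enc_bits x)
       (icp_Pi I).

Definition icp_removed_category (I : icp_input)
    (x : (icp_m1 I + icp_m2 I).-tuple bool) : Prop :=
  x \notin icp_Pi I /\ icp_h I x \in map (icp_h I) (icp_Pi I).

Definition icp_collision (I : icp_input)
    (x y : (icp_m1 I + icp_m2 I).-tuple bool) : Prop :=
  [/\ x != y, x \notin icp_Pi I, y \notin icp_Pi I,
      icp_p I x = icp_p I y & icp_h I x = icp_h I y].

(* A solution of the first kind is written x and one of the second kind x ++ y;
   m1 > 0 because 0 < k < 2 ^ m1, so their lengths differ. *)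
Definition InjectiveCategorizedPigeon : search_problem := {|
  instance w := exists I : icp_input, w = enc_icp_input I;
  solution w z := exists I : icp_input, w = enc_icp_input I /\
    ((exists x, icp_removed_category (I := I) x /\ z = x) \/
     (exists x y, icp_collision (I := I) x y /\ z = x ++ y))
|}.

Definition PPADS (R : search_problem) : Prop := reduces_to R SinkOfLine.

Definition PPADS_hard (Q : search_problem) : Prop :=
  forall R : search_problem, PPADS R -> reduces_to R Q.

(* Main.v *)
(* The reduction from Sink of Line to Injective Categorized Pigeon does not depend
   on the problem R in PPADS.  On inputs (b, c, x) with bits b, c and an n-bit x, let
   p(b, c, x) = b and
     h(0, c, x) = (c, x),    h(1, 1, x) = (1, x),
     h(1, 0, x) = (1, x) if P(S(x)) <> x, and (0, S(x)) otherwise,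
   and remove only (0, 0, s), whose category is (0, s).  If h(1, 0, x) = (0, s), then
   x = P(S(x)) = P(s) = s and S(s) = s, so no other element has that category.  Where
   P(S(x)) = x, S is injective, hence every collision is between (1, 0, x) and
   (1, 1, x) for a sink x, in one order or the other.  A solution u ++ v is thus
   mapped back by dropping two bits from its first half, without looking at the
   instance; no circuit has to be evaluated.

   The new instance is written by a few left-to-right passes over the old one with
   unary registers for wire numbers.  A Turing machine executes such passes in
   polynomial time on every input, also on words that encode no instance. *)

From Stdlib Require Import FunctionalExtensionality.
From HB Require Import structures.
From mathcomp Require Import all_boot zify.
Require Import Defs.

Set Implicit Arguments.
Unset Strict Implicit.
Unset Printing Implicit Defensive.

(** * Turing machines on infinite tapes *)

(** Without a collision, each category has two places, one per value of p. The half b = 0 takes one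
    place in every category. Removing (0, 0, s) closes the category (0, s), so the 2^(n+1) elements
    with b = 1 have only 2^(n+1) - 1 places and must collide. Here (1, 0, x) claims the place of its
    successor, while the places (1, x) are held by the elements (1, 1, x); a sink has no successor
    and is sent to such an occupied place. This is why the extra bit c is present.

    Most of the work is polynomial time. A reduction of R comes with arbitrary maps f and g, given
    only through machines. General composition is avoided: the machine of f is followed by one
    streaming program, and the machine of g is preceded by one change of its second input. The
    obstacle is what a machine leaves on its tapes. The streaming program therefore works on fresh
    tapes, whereas the machine of g must find initial tapes again; tapes as streams make this an
    equality, since erased cells and unlisted cells agree. *)

Definition stream := nat -> symbol.
Definition scons (a : symbol) (s : stream) : stream :=
  fun k => if k is k'.+1 then s k' else a.
Definition stail (s : stream) : stream := fun k => s k.+1.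

(* As in [tape], but with streams, so that trailing blanks do not matter. *)
Definition stape := (stream * stream)%type.
Definition shead (t : stape) : symbol := t.2 0.

Definition swrite (a : symbol * move) (t : stape) : stape :=
  let: (l, r) := (t.1, stail t.2) in
  match a.2 with
  | MoveLeft => (stail l, scons (l 0) (scons a.1 r))
  | Stay => (l, scons a.1 r)
  | MoveRight => (scons a.1 l, r)
  end.

Definition stape_of (t : tape) : stape := (nth None t.1, nth None t.2).

Lemma stape_of_write a t :
  stape_of (write_move a t) = swrite a (stape_of t).
Proof.
case: a t => a [] [l r]; rewrite /stape_of /swrite /write_move /=;
  congr pair; apply: functional_extensionality => -[|[|k]] //=;
  rewrite /stail /= ?nth_behead ?nth0 //; by case: l.
Qed.

Lemma shead_stape_of t : shead (stape_of t) = scanned t.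
Proof. by case: t => l []. Qed.

Lemma swrite_same t : swrite (shead t, Stay) t = t.
Proof.
case: t => l r; congr pair; apply: functional_extensionality.
by case.
Qed.

(* [tm_trans] exits with [None]; the exiting step still writes and moves. *)
Record tm (I : Type) := Tm {
  tm_state : finType;
  tm_start : tm_state;
  tm_trans : tm_state -> (I -> symbol) ->
             option tm_state * (I -> symbol * move)
}.

Definition heads (I : Type) (T : I -> stape) : I -> symbol :=
  fun i => shead (T i).
Definition write_all (I : Type) (act : I -> symbol * move) (T : I -> stape) :
    I -> stape := fun i => swrite (act i) (T i).

Definition noop (I : Type) (sy : I -> symbol) : I -> symbol * move :=
  fun i => (sy i, Stay).

Lemma write_noop (I : Type) (T : I -> stape) : write_all (noop (heads T)) T = T.
Proof. by apply: functional_extensionality => i; exact: swrite_same. Qed.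

(* [n] is an upper bound on the number of steps. *)
Inductive run_from (I : Type) (P : tm I) :
    tm_state P -> (I -> stape) -> (I -> stape) -> nat -> Prop :=
| RunExit s T act n :
    tm_trans s (heads T) = (None, act) ->
    run_from s T (write_all act T) n.+1
| RunMore s s' T T' act n :
    tm_trans s (heads T) = (Some s', act) ->
    run_from s' (write_all act T) T' n -> run_from s T T' n.+1.

Definition runs (I : Type) (P : tm I) := run_from (tm_start P).

Lemma run_from_mono (I : Type) (P : tm I) (s : tm_state P) T T' n m :
  run_from s T T' n -> n <= m -> run_from s T T' m.
Proof.
move=> run; elim: run m => {s T T' n} [s T act n E|s s' T T' act n E _ IH] [|m] // le.
  exact: RunExit.
exact: RunMore E (IH _ le).
Qed.

Lemma runs_mono (I : Type) (P : tm I) T T' n m :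
  runs P T T' n -> n <= m -> runs P T T' m.
Proof. exact: run_from_mono. Qed.

(* One-state machine: [f] tells whether to continue and what to write. *)
Definition cyc (I : Type)
    (f : (I -> symbol) -> bool * (I -> symbol * move)) : tm I :=
  Tm tt (fun _ sy => (if (f sy).1 then Some tt else None, (f sy).2)).

Lemma cyc_exit (I : Type) (f : (I -> symbol) -> bool * (I -> symbol * move)) T n :
  (f (heads T)).1 = false ->
  runs (cyc f) T (write_all (f (heads T)).2 T) n.+1.
Proof. by move=> E; apply: RunExit => /=; rewrite E. Qed.

Lemma cyc_more (I : Type) (f : (I -> symbol) -> bool * (I -> symbol * move)) T T' n :
  (f (heads T)).1 = true ->
  runs (cyc f) (write_all (f (heads T)).2 T) T' n ->
  runs (cyc f) T T' n.+1.
Proof. by move=> E; apply: RunMore => /=; rewrite E. Qed.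

Section Graph.

Variables (I : Type) (N : finType) (P : N -> tm I) (start : N)
  (next : N -> (I -> symbol) -> option N).

(** The extra state [None] of a node is one step after the exit of its program, so that [next] sees
    the symbols scanned after the last write and move. *)
Definition graph_state : finType := {v : N & option (tm_state (P v))}.
Definition enter (v : N) : graph_state :=
  existT (fun v => option (tm_state (P v))) v (Some (tm_start (P v))).
Definition leave (v : N) : graph_state :=
  existT (fun v => option (tm_state (P v))) v None.

(* Runs [P v]; when it exits, [next] chooses the node where to go on. *)
Definition graph : tm I :=
  @Tm I graph_state (enter start) (fun c sy =>
    match c with
    | existT v (Some s) =>
        let: (o, act) := tm_trans s sy in
        (Some (existT (fun v => option (tm_state (P v))) v o), act)
    | existT v None => (omap enter (next v sy), noop sy)
    end).

Lemma graph_node v T T1 T2 n m :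
  runs (P v) T T1 n -> @run_from I graph (leave v) T1 T2 m ->
  @run_from I graph (enter v) T T2 (n + m).
Proof.
rewrite /runs /enter; move: (tm_start _) => s.
move=> run cont.
elim: run cont => {s T T1 n} [s T act n E|s s' T T1 act n E _ IH] cont.
  rewrite addSn; apply: (@RunMore I graph _ (leave v) _ _ act) => /=; first by rewrite E.
  by apply: run_from_mono cont _; lia.
rewrite addSn; apply: RunMore (IH cont) => /=; by rewrite E.
Qed.

Lemma graph_next v v' T T' n :
  next v (heads T) = Some v' -> @run_from I graph (enter v') T T' n ->
  @run_from I graph (leave v) T T' n.+1.
Proof.
move=> E run; apply: (@RunMore I graph _ (enter v') _ _ (noop (heads T))).
  by rewrite /= E.
by rewrite write_noop.
Qed.

Lemma graph_exit v T n :
  next v (heads T) = None -> @run_from I graph (leave v) T T n.+1.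
Proof.
move=> E; rewrite -{2}[T]write_noop; apply: RunExit; by rewrite /= E.
Qed.

End Graph.

Definition tm_seq (I : Type) (P1 P2 : tm I) : tm I :=
  @graph I bool (fun b => if b then P1 else P2) true
    (fun b _ => if b then Some false else None).

(** The two additional steps are those spent in the [leave] states of the two nodes. *)
Lemma runs_seq (I : Type) (P1 P2 : tm I) T T1 T2 n m k :
  runs P1 T T1 n -> runs P2 T1 T2 m -> n + m + 2 <= k ->
  runs (tm_seq P1 P2) T T2 k.
Proof.
move=> run1 run2 le; apply: run_from_mono le.
have -> : n + m + 2 = n + (m + 1).+1 by lia.
pose P b := if b then P1 else P2; pose next (b : bool) (_ : I -> symbol) :=
  if b then Some false else None.
have node := @graph_node I bool P true next.
refine (@node true T T1 T2 n (m + 1).+1 run1 _).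
apply: (@graph_next I bool P true next true false) => //.
refine (@node false T1 T2 T2 m 1 run2 _).
by apply: (@graph_exit I bool P true next false).
Qed.

(** * Machines as subroutines *)

Section Embed.

Variables (M : machine) (J : finType).
Let I := ('I_(extra_tapes M).+2 + J)%type.

Definition join_tapes (A : 'I_(extra_tapes M).+2 -> stape) (B : J -> stape) :
    I -> stape := fun i => match i with inl j => A j | inr j => B j end.

Definition subroutine : tm I :=
  @Tm I (state M) (start M) (fun q sy =>
    if halting q then (None, noop sy) else
    let: (q', act) := transition q [ffun j => sy (inl j)] in
    (Some q', fun i => if i is inl j then act j else noop sy i)).

(** Halting is tested on the state before any transition, so the exit is a step of its own. *)
Lemma run_subroutine t (c : config M) B :
  halting (iter t (@step M) c).1 ->
  @run_from I subroutine c.1 (join_tapes (fun j => stape_of (c.2 j)) B)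
    (join_tapes (fun j => stape_of ((iter t (@step M) c).2 j)) B) t.+1.
Proof.
elim: t c => [|t IH] c halt.
  rewrite -{2}[join_tapes _ _]write_noop.
  by apply: RunExit => /=; rewrite halt.
(* A machine that halts before time [t.+1] is stationary from then on, so an early exit leaves the
   same tapes. *)
case E: (halting c.1).
  have -> : iter t.+1 (@step M) c = c.
    by elim: t.+1 => //= n ->; rewrite /step E.
  rewrite -{2}[join_tapes _ _]write_noop.
  by apply: RunExit => /=; rewrite E.
move: halt; rewrite iterSr => /IH; move: (iter t _ _) => c'.
rewrite /step E; case D: (transition _ _) => [q act] /= run.
pose act' (i : I) := if i is inl j then act j
  else noop (heads (join_tapes (fun j => stape_of (c.2 j)) B)) i.
apply: (@RunMore I subroutine _ q _ _ act').
  rewrite /= E; set sy := [ffun _ => _]; have -> : sy = [ffun i => scanned (c.2 i)].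
    by apply/ffunP => i; rewrite !ffunE -shead_stape_of.
  by rewrite D.
congr (run_from _ _ _ _): run; apply: functional_extensionality => -[j|j] /=.
  by rewrite ffunE stape_of_write.
by rewrite /write_all /act' /noop /heads /= swrite_same.
Qed.

Definition tape_ord (i : I) : 'I_(extra_tapes M + #|J|).+2 :=
  @unsplit (extra_tapes M).+2 #|J|
    (match i with inl j => inl j | inr j => inr (enum_rank j) end).
Definition ord_tape (i : 'I_(extra_tapes M + #|J|).+2) : I :=
  match @split (extra_tapes M).+2 #|J| i with
  | inl j => inl j | inr j => inr (enum_val j) end.

Lemma tape_ordK : cancel tape_ord ord_tape.
Proof. by rewrite /ord_tape => -[j|j]; rewrite /tape_ord unsplitK ?enum_rankK. Qed.

(** Output is read from tape 0, so the renumbering must keep that tape of [M] in place. *)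
Lemma tape_ord0 : tape_ord (inl ord0) = ord0.
Proof. exact: val_inj. Qed.

Definition machine_of (P : tm I) : machine :=
  @Machine (extra_tapes M + #|J|) (option (tm_state P)) (Some (tm_start P))
    (fun o => o == None)
    (fun o sy => if o is Some s then
       let: (o', act) := tm_trans s (fun i => sy (tape_ord i)) in
       (o', fun i => act (ord_tape i))
     else (None, fun i => (sy i, Stay))).

(** [n] only bounds the length of the run, while [iter] makes exactly [n] steps; the surplus is
    harmless because the halting state is stationary, by [haltE]. *)
Lemma machine_of_run P s T T' n (c : config (machine_of P)) :
  @run_from I P s T T' n -> c.1 = Some s ->
  (forall i, stape_of (c.2 (tape_ord i)) = T i) ->
  let c' := iter n (@step (machine_of P)) c in
  c'.1 = None /\ forall i, stape_of (c'.2 (tape_ord i)) = T' i.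
Proof.
have stepE s' (c0 : config (machine_of P)) T0 : c0.1 = Some s' ->
    (forall i, stape_of (c0.2 (tape_ord i)) = T0 i) ->
    (step c0).1 = (tm_trans s' (heads T0)).1 /\
    forall i, stape_of ((step c0).2 (tape_ord i))
      = write_all (tm_trans s' (heads T0)).2 T0 i.
  case: c0 => o tp /= -> Htp.
  have Hsy : (fun i => [ffun j => scanned (tp j)] (tape_ord i)) = heads T0.
    apply: functional_extensionality => i; rewrite ffunE /heads -Htp.
    by rewrite shead_stape_of.
  rewrite /step /= Hsy.
  case: (tm_trans _ _) => o' act /=; split=> // i.
  by rewrite ffunE tape_ordK stape_of_write Htp.
have haltE (c0 : config (machine_of P)) m : c0.1 = None ->
    iter m (@step (machine_of P)) c0 = c0.
  by move=> E; elim: m => //= m ->; rewrite /step /= E.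
move=> run; elim: run c => {s T T' n} [s T act n E|s s' T T' act n E _ IH] c Hc HT.
  have [] := stepE _ _ _ Hc HT; rewrite E /= => H1 H2.
  by rewrite -iterS iterSr haltE.
have [] := stepE _ _ _ Hc HT; rewrite E /= => H1 H2.
rewrite -iterS iterSr; exact: IH.
Qed.

End Embed.

Lemma size_blank_free_prefix s : size (blank_free_prefix s) <= size s.
Proof. by elim: s => //= -[b|] s IH. Qed.

(** The worst case is a move to the left with an empty right part: two cells become listed at
    once. *)
Lemma size_step (M : machine) (c : config M) i :
  size ((step c).2 i).2 <= (size (c.2 i).2).+2.
Proof.
rewrite /step; case: ifP => _; first lia.
case: (transition c.1 _) => q act /=.
rewrite ffunE; case: (act i) (c.2 i) => a [] [l r] /=; case: r => //= *; lia.
Qed.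

(** Time bounds the length of an intermediate result, and thereby the time of the program that reads
    it. *)
Lemma size_output (M : machine) inputs out t :
  computes_within M inputs out t -> size out <= size (nth [::] inputs 0) + 2 * t.
Proof.
case=> _ <-; apply: leq_trans (size_blank_free_prefix _) _.
elim: t => [|t IH]; first by rewrite /= ffunE /= size_map muln0 addn0.
by rewrite iterS; apply: leq_trans (size_step _ _) _; lia.
Qed.

(** * Polynomial bounds *)

(** With base [n.+1], powers grow with the exponent even at n = 0, so sums need no case
    distinction. *)
Definition poly_bounded (p : nat -> nat) : Prop :=
  exists c d, forall n, p n <= c * n.+1 ^ d.

Lemma poly_bounded_const c : poly_bounded (fun=> c).
Proof. by exists c, 0 => n; rewrite expn0 muln1. Qed.

Lemma poly_bounded_id : poly_bounded id.
Proof. by exists 1, 1 => n; rewrite mul1n expn1. Qed.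

Lemma poly_bounded_add p q :
  poly_bounded p -> poly_bounded q -> poly_bounded (fun n => p n + q n).
Proof.
move=> [c [d Ep]] [c' [d' Eq]]; exists (c + c'), (d + d') => n.
rewrite mulnDl leq_add //.
  by apply: leq_trans (Ep n) _; rewrite leq_mul2l leq_pexp2l ?leq_addr ?orbT.
by apply: leq_trans (Eq n) _; rewrite leq_mul2l leq_pexp2l ?leq_addl ?orbT.
Qed.

Lemma poly_bounded_mul p q :
  poly_bounded p -> poly_bounded q -> poly_bounded (fun n => p n * q n).
Proof.
move=> [c [d Ep]] [c' [d' Eq]]; exists (c * c'), (d + d') => n.
by rewrite expnD mulnACA leq_mul.
Qed.

Lemma poly_bounded_comp p q :
  poly_bounded p -> poly_bounded q -> poly_bounded (fun n => p (q n)).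
Proof.
move=> [c [d Ep]] [c' [d' Eq]]; exists (c * c'.+1 ^ d), (d' * d) => n.
apply: leq_trans (Ep _) _; rewrite -mulnA leq_mul2l expnM -expnMn.
apply/orP; right; case: (d) => // d0; rewrite leq_exp2r //.
by rewrite mulSn -add1n leq_add ?expn_gt0.
Qed.

Lemma poly_bounded_exp d : poly_bounded (fun n => n ^ d).
Proof. by exists 1, d => n; rewrite mul1n; case: d => // d; rewrite leq_exp2r. Qed.

(** For n > 0, n + 1 <= 2n yields the factor 2^d; the additive term covers n = 0. *)
Lemma poly_boundedE p :
  poly_bounded p -> exists a d, forall n, p n <= a * n ^ d + a.
Proof.
move=> [c [d E]]; exists (c * 2 ^ d), d => n; apply: leq_trans (E n) _.
case: n => [|n].
  by rewrite exp1n muln1; apply: leq_trans (leq_addl _ _); rewrite leq_pmulr // expn_gt0.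
apply: leq_trans (leq_addr _ _); rewrite -mulnA -expnMn leq_mul2l.
apply/orP; right; case: d {E} => // d; rewrite leq_exp2r //; lia.
Qed.

Ltac solve_poly := repeat first
  [ assumption | apply: poly_bounded_const | apply: poly_bounded_id
  | apply: poly_bounded_exp | apply: poly_bounded_add | apply: poly_bounded_mul ].

(** * Words on tapes *)

Definition wtape (pre suf : word) : stape :=
  (nth None (map Some (rev pre)), nth None (map Some suf)).

Lemma stape_eq (t t' : stape) : t.1 =1 t'.1 -> t.2 =1 t'.2 -> t = t'.
Proof.
by case: t t' => l r [l' r'] /= /functional_extensionality-> /functional_extensionality->.
Qed.

Lemma shead_wtape pre suf : shead (wtape pre suf) = ohead suf.
Proof. by case: suf. Qed.

Lemma wtape_right b pre suf :
  swrite (Some b, MoveRight) (wtape pre suf) = wtape (rcons pre b) (behead suf).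
Proof.
apply: stape_eq => k; rewrite /= ?rev_rcons; first by case: k.
by case: suf => // ; case: k.
Qed.

Lemma wtape_left b pre suf :
  swrite (shead (wtape (rcons pre b) suf), MoveLeft) (wtape (rcons pre b) suf)
  = wtape pre (b :: suf).
Proof.
apply: stape_eq => k; rewrite /= ?rev_rcons //.
by case: k => //= -[|k] //=; case: suf.
Qed.

Lemma wtape_erase b pre :
  swrite (None, MoveLeft) (wtape (rcons pre b) [::]) = wtape pre [:: b].
Proof. exact: (wtape_left b pre [::]). Qed.

Lemma swrite_left_right t :
  let t' := swrite (shead t, MoveLeft) t in swrite (shead t', MoveRight) t' = t.
Proof. by case: t => l r; apply: stape_eq => -[]. Qed.

(** The counterpart of [blank_free_prefix] on streams, as a relation because a stream may have no
    blank at all. *)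
Fixpoint reads (s : stream) (w : word) : Prop :=
  if w is b :: w' then s 0 = Some b /\ reads (stail s) w' else s 0 = None.

Lemma reads_blank_free_prefix s w : reads (nth None s) w -> blank_free_prefix s = w.
Proof.
elim: w s => [|b w IH] [|a s] //=; try by case.
  by move=> ->.
by case=> -> rd; congr cons; apply: IH.
Qed.

Lemma reads_nth s : reads (nth None s) (blank_free_prefix s).
Proof. by elim: s => [|[b|] s IH]. Qed.

Definition touch (I : Type) (u : I -> option (symbol * move)) (sy : I -> symbol) :
    I -> symbol * move := fun i => odflt (sy i, Stay) (u i).

Lemma write_touch (I : Type) (u : I -> option (symbol * move)) T :
  write_all (touch u (heads T)) T
  = fun i => if u i is Some a then swrite a (T i) else T i.
Proof.
apply: functional_extensionality => i; rewrite /write_all /touch.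
by case: (u i) => //=; rewrite swrite_same.
Qed.

Definition skip (I : Type) : tm I := cyc (fun sy => (false, noop sy)).

Lemma runs_skip (I : Type) T n : runs (skip I) T T n.+1.
Proof.
by rewrite -{2}[T]write_noop; apply: (cyc_exit (f := fun sy => (false, noop sy))).
Qed.

(** * Elementary operations on a single tape *)

Section TapeOps.

Variable I : eqType.

Definition upd (i : I) (t : stape) (T : I -> stape) : I -> stape :=
  fun j => if j == i then t else T j.

Definition at_tape (i : I) (a : symbol * move) : I -> option (symbol * move) :=
  fun j => if j == i then Some a else None.
Definition at_tapes (i1 : I) (a1 : symbol * move) (i2 : I) (a2 : symbol * move) :
    I -> option (symbol * move) :=
  fun j => if j == i1 then Some a1 else if j == i2 then Some a2 else None.

Lemma write_at_tape i a T :
  write_all (touch (at_tape i a) (heads T)) T = upd i (swrite a (T i)) T.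
Proof.
rewrite write_touch; apply: functional_extensionality => j.
by rewrite /at_tape /upd; case: eqP => // ->.
Qed.

Lemma write_at_tapes i1 a1 i2 a2 T : i2 != i1 ->
  write_all (touch (at_tapes i1 a1 i2 a2) (heads T)) T
  = upd i2 (swrite a2 (T i2)) (upd i1 (swrite a1 (T i1)) T).
Proof.
move=> ne; rewrite write_touch; apply: functional_extensionality => j.
rewrite /at_tapes /upd; case: (eqVneq j i2) => [->|_]; first by rewrite (negbTE ne).
by case: (eqVneq j i1) => [->|_].
Qed.

Lemma upd_same i t T : upd i t T i = t. Proof. by rewrite /upd eqxx. Qed.
Lemma upd_id i T : upd i (T i) T = T.
Proof. by apply: functional_extensionality => j; rewrite /upd; case: eqP => // ->. Qed.
Lemma upd_upd i t t' T : upd i t (upd i t' T) = upd i t T.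
Proof. by apply: functional_extensionality => j; rewrite /upd; case: eqP. Qed.
Lemma upd_other i j t T : j != i -> upd i t T j = T j.
Proof. by rewrite /upd => /negbTE ->. Qed.
Lemma upd_comm i j t t' T : i != j ->
  upd i t (upd j t' T) = upd j t' (upd i t T).
Proof.
move=> ne; apply: functional_extensionality => x; rewrite /upd.
by case: (eqVneq x i) ne => [->|_] // /negbTE ->.
Qed.

Definition tm_step (i : I) (a : symbol -> symbol * move) : tm I :=
  cyc (fun sy => (false, touch (at_tape i (a (sy i))) sy)).

Lemma runs_step i a T n :
  runs (tm_step i a) T (upd i (swrite (a (shead (T i))) (T i)) T) n.+1.
Proof.
rewrite -write_at_tape.
exact: (@cyc_exit _ (fun sy => (false, touch (at_tape i (a (sy i))) sy))).
Qed.

Definition tm_back (i : I) : tm I := tm_step i (fun a => (a, MoveLeft)).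

Definition tm_loop (i : I) (a b : symbol -> symbol * move) : tm I :=
  cyc (fun sy => (isSome (sy i),
    touch (at_tape i (if sy i is Some _ then a (sy i) else b (sy i))) sy)).

Lemma loop_more i a b T T' n :
  isSome (shead (T i)) ->
  runs (tm_loop i a b) (upd i (swrite (a (shead (T i))) (T i)) T) T' n ->
  runs (tm_loop i a b) T T' n.+1.
Proof.
move=> E run; apply: cyc_more; first exact: E.
have Ea : (if heads T i is Some _ then a (heads T i) else b (heads T i))
    = a (shead (T i)) by rewrite /heads; case: (shead _) E.
by rewrite /= Ea write_at_tape.
Qed.

Lemma loop_exit i a b T n :
  shead (T i) = None ->
  runs (tm_loop i a b) T (upd i (swrite (b None) (T i)) T) n.+1.
Proof.
move=> E; rewrite -write_at_tape; set u := at_tape _ _.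
have -> : touch u (heads T) = (isSome (heads T i), touch (at_tape i
    (if heads T i is Some _ then a (heads T i) else b (heads T i))) (heads T)).2.
  by rewrite /heads /= E.
by apply: cyc_exit; rewrite /heads E.
Qed.

Definition keep_left (a : symbol) : symbol * move := (a, MoveLeft).
Definition keep_right (a : symbol) : symbol * move := (a, MoveRight).
Definition keep_stay (a : symbol) : symbol * move := (a, Stay).

(** The loop stops at a blank, and the head may stand on the blank after the word, hence the step to
    the left before it. The exit step moves right, from the blank before the word to its first
    letter. *)
Definition tm_rewind (i : I) : tm I :=
  tm_seq (tm_back i) (tm_loop i keep_left keep_right).

Lemma runs_rewind i T pre suf n :
  T i = wtape pre suf -> size pre + 4 <= n ->
  runs (tm_rewind i) T (upd i (wtape [::] (pre ++ suf)) T) n.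
Proof.
move=> E le; apply: (runs_seq (n := 1) (m := (size pre).+1)); [exact: runs_step| |by lia].
rewrite E {n le}; elim/last_ind: pre suf T E => [|pre b IH] suf T E.
  rewrite -[in X in runs _ _ X _](swrite_left_right (wtape [::] suf)) /=.
  set t := swrite _ (wtape _ _).
  have := @loop_exit i keep_left keep_right (upd i t T) 0.
  by rewrite upd_same upd_upd; apply.
have E' : upd i (wtape pre (b :: suf)) T i = wtape pre (b :: suf) by rewrite upd_same.
have := IH _ _ E'; rewrite wtape_left size_rcons cat_rcons !upd_upd => run.
by apply: loop_more; rewrite upd_same // upd_upd.
Qed.

Definition tm_forward (i : I) : tm I := tm_loop i keep_right keep_stay.

Lemma runs_forward i T pre suf n :
  T i = wtape pre suf -> size suf < n ->
  runs (tm_forward i) T (upd i (wtape (pre ++ suf) [::]) T) n.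
Proof.
move=> E le; apply: runs_mono le.
elim: suf pre T E => [|b suf IH] pre T E.
  have := @loop_exit i keep_right keep_stay T 0; rewrite E => /(_ erefl).
  by rewrite (swrite_same (wtape pre [::])) cats0.
have := IH _ _ (upd_same i (wtape (rcons pre b) suf) T).
rewrite upd_upd cat_rcons => run.
by apply: loop_more; rewrite E // shead_wtape wtape_right.
Qed.

Lemma nseq_rcons c : nseq c.+1 true = rcons (nseq c true) true.
Proof. by elim: c => //= c {1}->. Qed.

End TapeOps.

(** * Multi-pass streaming programs with unary registers *)

Section Stream.

Variable R : finType.

(** No operation tests a register: the control flow is that of the finite automaton [delta] alone,
    and a pass always ends with its input. *)
Inductive op := Emit of bool | Inc of R | Reset of R | EmitReg of R.

Record store := Store { regs : R -> nat; out : word }.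

Definition set_reg (f : R -> nat) (r : R) (v : nat) : R -> nat :=
  fun r' => if r' == r then v else f r'.

Definition run_op (o : op) (st : store) : store :=
  match o with
  | Emit b => Store (regs st) (rcons (out st) b)
  | Inc r => Store (set_reg (regs st) r (regs st r).+1) (out st)
  | Reset r => Store (set_reg (regs st) r 0) (out st)
  | EmitReg r => Store (regs st) (out st ++ nseq (regs st r) true)
  end.

Definition run_ops (ops : seq op) (st : store) : store :=
  foldl (fun st o => run_op o st) st ops.

Section Scan.

Variables (Q : finType) (delta : Q -> bool -> Q) (q0 : Q).

Fixpoint scan (em : Q -> bool -> seq op) (q : Q) (w : word) (st : store) :=
  if w is b :: w' then scan em (delta q b) w' (run_ops (em q b) st) else st.

(* Operations before reading the input, and operations at each input bit. *)
Definition pass := (seq op * (Q -> bool -> seq op))%type.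

Definition run_pass (w : word) (st : store) (p : pass) : store :=
  scan p.2 q0 w (run_ops p.1 st).

Definition run_passes (ps : seq pass) (w : word) : word :=
  out (foldl (run_pass w) (Store (fun=> 0) [::]) ps).

(** * Execution of streaming programs by machines *)

Section Machine.

Variable k : nat.
Let I := ('I_k.+2 + option (option R))%type.

Definition input_tape : I := inr None.
Definition output_tape : I := inr (Some None).
Definition reg_tape (r : R) : I := inr (Some (Some r)).

Definition tapes (A : 'I_k.+2 -> stape) (X : stape) (st : store) : I -> stape :=
  fun i => match i with
  | inl j => A j
  | inr None => X
  | inr (Some None) => wtape (out st) [::]
  | inr (Some (Some r)) => wtape (nseq (regs st r) true) [::]
  end.

Definition emit_step (i : I) (sy : I -> symbol) : bool * (I -> symbol * move) :=
  if sy i is Some _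
  then (true, touch (at_tapes i (Some true, MoveLeft)
                              output_tape (Some true, MoveRight)) sy)
  else (false, touch (at_tape i (None, MoveRight)) sy).

Definition tm_emit (i : I) : tm I := cyc (emit_step i).

(** The register tape is described one move to the left of [t], so that an empty register, whose
    head already stands on the blank before it, is the base case. The letters survive; only the head
    ends at the left, and [tm_forward] brings it back. *)
Lemma runs_emit i T w c suf : output_tape != i ->
  let t := wtape (nseq c true) suf in
  T output_tape = wtape w [::] -> T i = swrite (shead t, MoveLeft) t ->
  runs (tm_emit i) T
    (upd output_tape (wtape (w ++ nseq c true) [::])
      (upd i (wtape [::] (nseq c true ++ suf)) T)) c.+1.
Proof.
move=> ne; elim: c w suf T => [|c IH] w suf T t TY Ti.
  have E : heads T i = None by rewrite /heads Ti.
  have -> : wtape [::] (nseq 0 true ++ suf) = swrite (shead (T i), MoveRight) (T i).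
    by rewrite Ti -[LHS]swrite_left_right.
  rewrite cats0 -TY.
  have -> : T output_tape = upd i (swrite (shead (T i), MoveRight) (T i)) T output_tape.
    by rewrite upd_other.
  rewrite upd_id -write_at_tape [shead (T i)]E.
  have -> : touch (at_tape i (None, MoveRight)) (heads T) = (emit_step i (heads T)).2.
    by rewrite /emit_step E.
  by apply: cyc_exit; rewrite /emit_step E.
move: Ti; rewrite /t nseq_rcons wtape_left => Ti.
have E : heads T i = Some true by rewrite /heads Ti.
apply: cyc_more; rewrite /emit_step E //= write_at_tapes // TY Ti wtape_right.
have ne' : i != output_tape by rewrite eq_sym.
set T' := upd output_tape _ (upd i _ T).
have TY' : T' output_tape = wtape (rcons w true) [::] by rewrite /T' upd_same.
have T'i : T' i = swrite (shead (wtape (nseq c true) (true :: suf)), MoveLeft)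
    (wtape (nseq c true) (true :: suf)) by rewrite /T' upd_other // upd_same.
have := IH _ _ _ TY' T'i.
by rewrite /T' (@upd_comm _ i) // !upd_upd !cat_rcons -nseq_rcons.
Qed.

Definition tm_op (o : op) : tm I :=
  match o with
  | Emit b => tm_step output_tape (fun=> (Some b, MoveRight))
  | Inc r => tm_step (reg_tape r) (fun=> (Some true, MoveRight))
  | Reset r => tm_seq (tm_back (reg_tape r))
      (tm_loop (reg_tape r) (fun=> (None, MoveLeft)) (fun=> (None, MoveRight)))
  | EmitReg r => tm_seq (tm_back (reg_tape r)) (tm_seq
(tm_emit (reg_tape r)) (tm_forward (reg_tape r)))
  end.

Lemma tapes_output A X st w :
  upd output_tape (wtape w [::]) (tapes A X st) = tapes A X (Store (regs st) w).
Proof. by apply: functional_extensionality => -[|[[]|]]. Qed.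

Lemma tapes_input A X X' st :
  upd input_tape X' (tapes A X st) = tapes A X' st.
Proof. by apply: functional_extensionality => -[|[[]|]]. Qed.

Lemma tapes_reg A X st r c :
  upd (reg_tape r) (wtape (nseq c true) [::]) (tapes A X st)
  = tapes A X (Store (set_reg (regs st) r c) (out st)).
Proof.
apply: functional_extensionality => -[|[[r'|]|]] //=.
by rewrite /upd /= /set_reg -[_ == _]/(r' == r); case: eqP.
Qed.

Lemma runs_op o A X st B :
  (forall r, regs st r <= B) ->
  runs (tm_op o) (tapes A X st) (tapes A X (run_op o st)) (2 * B + 10).
Proof.
have -> n : n + 10 = (n + 9).+1 by lia.
move=> leB; case: o => [b|r|r|r] /=.
- have := runs_step output_tape (fun=> (Some b, MoveRight)) (tapes A X st) (2 * B + 9).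
  by rewrite /= wtape_right tapes_output.
- have := runs_step (reg_tape r) (fun=> (Some true, MoveRight)) (tapes A X st) (2 * B + 9).
  by rewrite /= wtape_right -nseq_rcons tapes_reg.
- apply: (runs_seq (n := 1) (m := (regs st r).+1)); [exact: runs_step| |by have := leB r; lia].
  rewrite /= -tapes_reg; move: (tapes A X st) (regs st r) => T c.
  elim: c T => [|c IH] T.
    rewrite -[in X in runs _ _ X _](swrite_left_right (wtape (nseq 0 true) [::])).
    set t := swrite _ (wtape _ _).
    have := @loop_exit _ (reg_tape r) (fun=> (None, MoveLeft))
      (fun=> (None, MoveRight)) (upd (reg_tape r) t T) 0.
    by rewrite upd_same upd_upd; apply.
  rewrite nseq_rcons wtape_erase; apply: loop_more; first by rewrite upd_same.
  rewrite upd_same upd_upd.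
  (* Blanking the letter just reached gives the same stream as if it had never been written, so the
     shorter register is recovered exactly. *)
  have -> : swrite (None, MoveLeft) (wtape (nseq c true) [:: true])
    = swrite (None, MoveLeft) (wtape (nseq c true) [::]).
    by apply: stape_eq => // -[|[|[]]].
  exact: IH.
have le := leB r.
apply: (runs_seq (n := 1) (m := 2 * regs st r + 4)); [exact: runs_step| |by lia].
rewrite /= -tapes_output; set T := tapes A X st.
have TY : T output_tape = wtape (out st) [::] by [].
have Tr : T (reg_tape r) = wtape (nseq (regs st r) true) [::] by [].
rewrite {}/T in TY Tr *; move: (tapes A X st) (regs st r) (out st) Tr TY {le leB} => T c w Tr TY.
set T1 := upd (reg_tape r) _ _.
have T1Y : T1 output_tape = wtape w [::] by rewrite /T1 upd_other.
have T1r : T1 (reg_tape r) = swrite (None, MoveLeft) (wtape (nseq c true) [::]) by rewrite /T1 upd_same.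
have run1 := @runs_emit (reg_tape r) T1 w c [::] isT T1Y T1r.
apply: (runs_seq run1); last by instantiate (1 := c.+1); lia.
set T2 := upd output_tape _ _.
have T2r : T2 (reg_tape r) = wtape [::] (nseq c true).
  by rewrite /T2 upd_other // upd_same cats0.
have := runs_forward T2r; rewrite /= => /(_ c.+1); rewrite size_nseq => /(_ (leqnn _)).
congr (runs _ _ _ _).
by rewrite /T2 (@upd_comm _ (reg_tape r)) // upd_upd /T1 upd_upd -Tr upd_id.
Qed.

Definition tm_ops (ops : seq op) : tm I :=
  foldr (fun o => tm_seq (tm_op o)) (skip I) ops.

Lemma run_op_bounds o st B :
  (forall r, regs st r <= B) ->
  (forall r, regs (run_op o st) r <= B.+1) /\
  size (out (run_op o st)) <= size (out st) + B.+1.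
Proof.
move=> leB; have leB' r : regs st r <= B.+1 by apply: leqW.
case: o => [b|r|r|r] /=; split=> //; rewrite ?size_rcons ?size_cat ?size_nseq; try lia.
- by move=> r'; rewrite /set_reg; case: eqP => // _; rewrite ltnS.
- by move=> r'; rewrite /set_reg; case: eqP.
- by rewrite leq_add2l.
Qed.

Lemma runs_ops ops A X st B :
  (forall r, regs st r <= B) ->
  let S := B + size ops in
  [/\ runs (tm_ops ops) (tapes A X st) (tapes A X (run_ops ops st))
        (size ops * (2 * S + 12) + 1),
      forall r, regs (run_ops ops st) r <= S
    & size (out (run_ops ops st)) <= size (out st) + size ops * S].
Proof.
elim: ops st B => [|o ops IH] st B leB.
  by split=> [|r|]; rewrite ?addn0 //; exact: runs_skip.
have [leB1 leo] := run_op_bounds o leB.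
have [run leB2 leo2] := IH _ _ leB1; rewrite /= -(addSnnS B); split; [|exact: leB2|].
  by apply: (runs_seq (runs_op o A X leB) run); rewrite mulSn; lia.
by apply: leq_trans leo2 _; rewrite mulSn; lia.
Qed.

Definition scan_node (em : Q -> bool -> seq op) (v : Q * option bool) : tm I :=
  if v.2 is Some b then tm_seq (tm_ops (em v.1 b)) (tm_step input_tape keep_right)
  else skip I.

Definition scan_next (v : Q * option bool) (sy : I -> symbol) :
    option (Q * option bool) :=
  if v.2 is Some b then Some (delta v.1 b, None)
  else omap (fun b => (v.1, Some b)) (sy input_tape).

Definition tm_scan (em : Q -> bool -> seq op) : tm I :=
  graph (scan_node em) (q0, None) scan_next.

(** At most [L] operations are made per letter and each raises a register by at most one, so [S]
    bounds every register throughout the scan and makes the cost of a letter uniform. *)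
Lemma runs_scan em L S w q pre st A B :
  (forall q b, size (em q b) <= L) -> B + L * size w <= S ->
  (forall r, regs st r <= B) ->
  [/\ @run_from I (tm_scan em) (enter (scan_node em) (q, None))
        (tapes A (wtape pre w) st) (tapes A (wtape (pre ++ w) [::]) (scan em q w st))
        (size w * (L * (2 * S + 12) + 10) + 3),
      forall r, regs (scan em q w st) r <= S
    & size (out (scan em q w st)) <= size (out st) + size w * (L * S)].
Proof.
move=> leL; elim: w q pre st B => [|b w IH] q pre st B leS leB.
  split=> [|r|]; last by rewrite /= addn0.
    apply: (@graph_node I _ _ (q0, None) scan_next (q, None) _ _ _ 1 2) (runs_skip _ _) _.
    by rewrite cats0; apply: graph_exit.
  by apply: leq_trans (leB r) _; lia.
have [run leB1 leo1] := runs_ops (em q b) A (wtape pre (b :: w)) leB.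
have leS' : B + size (em q b) <= S.
  by apply: leq_trans leS; rewrite leq_add2l mulnS; apply: leq_trans (leL q b) (leq_addr _ _).
have leS1 : B + size (em q b) + L * size w <= S.
  by apply: leq_trans leS; rewrite -addnA leq_add2l /= mulnS leq_add2r.
have [run2 leB2 leo2] := IH (delta q b) (rcons pre b) _ _ leS1 leB1.
have le1 : size (em q b) * (2 * (B + size (em q b)) + 12) <= L * (2 * S + 12).
  by apply: leq_mul => //; lia.
have le2 : size (em q b) * (B + size (em q b)) <= L * S by apply: leq_mul.
split=> //; last by rewrite /= mulSn; lia.
set n := _ * _ + 3.
have -> : n = 1 + (n - 2).+1 by rewrite /n /= mulSn; lia.
apply: (@graph_node I _ _ (q0, None) scan_next (q, None)) (runs_skip _ _) _.
apply: (@graph_next _ _ _ _ _ _ (q, Some b)) => //.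
have -> : n - 2 = (L * (2 * S + 12) + 4) + ((n - 2) - (L * (2 * S + 12) + 4)).
  by rewrite /n /= mulSn; lia.
have step : runs (scan_node em (q, Some b)) (tapes A (wtape pre (b :: w)) st)
    (tapes A (wtape (rcons pre b) w) (run_ops (em q b) st)) (L * (2 * S + 12) + 4).
  have := runs_step input_tape keep_right
    (tapes A (wtape pre (b :: w)) (run_ops (em q b) st)) 0.
  rewrite tapes_input [swrite _ _]wtape_right => run1.
  by apply: (runs_seq run run1); lia.
apply: (@graph_node I _ _ (q0, None) scan_next (q, Some b)) step _.
have -> : n - 2 - (L * (2 * S + 12) + 4)
    = (n - 2 - (L * (2 * S + 12) + 4)).-1.+1 by rewrite /n /= mulSn; lia.
apply: (@graph_next _ _ _ _ _ _ (delta q b, None)) => //.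
rewrite cat_rcons in run2; apply: run_from_mono run2 _.
rewrite /n /= mulSn; lia.
Qed.

Definition tm_pass (p : pass) : tm I :=
  tm_seq (tm_ops p.1) (tm_seq (tm_scan p.2) (tm_rewind input_tape)).

(** [B'] can be chosen before the word because [L] is a maximum over the finitely many pairs of a
    state and a bit. *)
Lemma runs_pass (p : pass) (B : nat -> nat) : poly_bounded B ->
  exists2 B' : nat -> nat, poly_bounded B' & forall w A st,
    (forall r, regs st r <= B (size w)) -> size (out st) <= B (size w) ->
    [/\ runs (tm_pass p) (tapes A (wtape [::] w) st)
          (tapes A (wtape [::] w) (run_pass w st p)) (B' (size w)),
        forall r, regs (run_pass w st p) r <= B' (size w)
      & size (out (run_pass w st p)) <= B' (size w)].
Proof.
move=> polyB; pose L := \max_(x : Q * bool) size (p.2 x.1 x.2); pose m := size p.1.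
have leL q b : size (p.2 q b) <= L.
  exact: (leq_bigmax (F := fun x : Q * bool => size (p.2 x.1 x.2)) (q, b)).
pose S n := B n + m + L * n.
have polyS : poly_bounded S.
  by solve_poly.
exists (fun n => m * (2 * S n + 12) + n * (L * (2 * S n + 12) + 10) + n + 20 + S n).
  by solve_poly.
move=> w A st leB leo; set n := size w.
have [run leB1 leo1] := runs_ops p.1 A (wtape [::] w) leB.
have leS : B n + m + L * n <= S n by [].
have [run2 leB2 leo2] := runs_scan q0 [::] A leL leS leB1.
have run3 : runs (tm_rewind input_tape)
    (tapes A (wtape ([::] ++ w) [::]) (run_pass w st p))
    (tapes A (wtape [::] w) (run_pass w st p)) (n + 4).
  have := @runs_rewind _ input_tape (tapes A (wtape w [::]) (run_pass w st p))
    w [::] (n + 4) erefl (leqnn _).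
  by rewrite tapes_input cats0.
have lem : m * (B n + m) <= m * (2 * S n + 12) by apply: leq_mul => //; rewrite /S; lia.
have lem' : m * (2 * (B n + m) + 12) <= m * (2 * S n + 12) by apply: leq_mul => //; rewrite /S; lia.
have lem2 : n * (L * S n) <= n * (L * (2 * S n + 12) + 10).
  by rewrite leq_mul2l; apply/orP; right; apply: leq_trans (leq_addr _ _); rewrite leq_mul2l; lia.
split=> [|r|].
- apply: (runs_seq run); first by apply: (runs_seq run2 run3); exact: leqnn.
  by rewrite -/m -/n; lia.
- by apply: leq_trans (leB2 r) _; rewrite leq_addl.
- have leBS : B n <= S n by rewrite /S; lia.
  by move: lem lem2 leo leo1 leo2; rewrite /run_pass -/m -/n; lia.
Qed.

Definition tm_passes (ps : seq pass) : tm I :=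
  foldr (fun p => tm_seq (tm_pass p)) (skip I) ps.

(** Each pass may enlarge the bounds, but the number of passes does not depend on the input, so they
    stay polynomial. *)
Lemma runs_passes (ps : seq pass) (B : nat -> nat) : poly_bounded B ->
  exists2 B' : nat -> nat, poly_bounded B' & forall w A st,
    (forall r, regs st r <= B (size w)) -> size (out st) <= B (size w) ->
    let st' := foldl (run_pass w) st ps in
    runs (tm_passes ps) (tapes A (wtape [::] w) st) (tapes A (wtape [::] w) st')
      (B' (size w)) /\ size (out st') <= B' (size w).
Proof.
elim: ps B => [|p ps IH] B polyB.
  exists (fun n => B n + 1); first by solve_poly.
  move=> w A st _ leo /=; rewrite addn1; split; first exact: runs_skip.
  exact: leqW.
have [B1 polyB1 H1] := runs_pass p polyB.
have [B2 polyB2 H2] := IH _ polyB1.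
exists (fun n => B1 n + B2 n + 2); first by solve_poly.
move=> w A st leB leo st'.
have [run1 leB1 leo1] := H1 w A st leB leo.
have [run2 leo2] := H2 w A _ leB1 leo1.
split; first by apply: (runs_seq run1 run2).
by apply: leq_trans leo2 _; lia.
Qed.

(** To the left of its head and beyond the first blank, tape 0 may hold remains of an earlier
    computation; a fresh copy makes them irrelevant. *)
Definition copy_step (sy : I -> symbol) : bool * (I -> symbol * move) :=
  if sy (inl ord0) is Some b
  then (true, touch (at_tapes (inl ord0) (Some b, MoveRight)
                              input_tape (Some b, MoveRight)) sy)
  else (false, noop sy).

Definition tm_copy : tm I := cyc copy_step.

Lemma runs_copy A st l s pre :
  A ord0 = (l, nth None s) -> exists A',
  runs tm_copy (tapes A (wtape pre [::]) st)
    (tapes A' (wtape (pre ++ blank_free_prefix s) [::]) st)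
    (size (blank_free_prefix s)).+1.
Proof.
elim: s l A pre => [|a s IH] l A pre A0.
  exists A; rewrite /= cats0; set T := tapes _ _ _.
  rewrite -{2}[T]write_noop.
  have -> : noop (heads T) = (copy_step (heads T)).2.
    by rewrite /copy_step /heads /= A0.
  by apply: cyc_exit; rewrite /copy_step /heads /= A0.
case: a A0 => [b|] A0; last first.
  exists A; rewrite /= cats0; set T := tapes _ _ _.
  rewrite -{2}[T]write_noop.
  have -> : noop (heads T) = (copy_step (heads T)).2.
    by rewrite /copy_step /heads /= A0.
  by apply: cyc_exit; rewrite /copy_step /heads /= A0.
pose A1 j := if j == ord0 then swrite (Some b, MoveRight) (A j) else A j.
have A10 : A1 ord0 = (scons (Some b) l, nth None s).
  by rewrite /A1 eqxx A0.
have [A' run] := IH _ _ (rcons pre b) A10.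
exists A'; rewrite /= -cat_rcons; set T := tapes A _ _.
have E : heads T (inl ord0) = Some b by rewrite /heads /= A0.
apply: cyc_more; rewrite /copy_step E //=.
rewrite write_at_tapes // [T input_tape]/= wtape_right.
congr (runs _ _ _ _): run; apply: functional_extensionality => -[j|[[r|]|]] //.
by rewrite /upd /= /A1 -[inl j == inl ord0]/(j == ord0); case: eqP => // ->.
Qed.

Definition output_step (sy : I -> symbol) : bool * (I -> symbol * move) :=
  if sy output_tape is Some b
  then (true, touch (at_tapes (inl ord0) (Some b, MoveLeft)
                              output_tape (Some b, MoveLeft)) sy)
  else (false, touch (at_tape (inl ord0) (sy (inl ord0), MoveRight)) sy).

(* Writes the output on tape 0 from right to left, so that the head ends on its
   first letter. *)
Definition tm_output : tm I :=
  tm_seq (tm_seq (tm_back output_tape)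
            (tm_step (inl ord0) (fun=> (None, MoveLeft))))
    (cyc output_step).

(** [v] is the part of the output already standing to the right of the head on tape 0. *)
Lemma runs_output_loop T w suf v :
  let t := wtape w suf in
  T output_tape = swrite (shead t, MoveLeft) t ->
  reads (stail (T (inl ord0)).2) v -> exists2 T',
  runs (cyc output_step) T T' (size w).+1 & reads (T' (inl ord0)).2 (w ++ v).
Proof.
elim/last_ind: w suf v T => [|w b IH] suf v T t TY T0.
  exists (upd (inl ord0) (swrite (shead (T (inl ord0)), MoveRight) (T (inl ord0))) T).
    have E : heads T output_tape = None by rewrite /heads TY.
    rewrite -write_at_tape -[shead _]/(heads T (inl ord0)).
    have -> : touch (at_tape (inl ord0) (heads T (inl ord0), MoveRight)) (heads T)
        = (output_step (heads T)).2 by rewrite /output_step E.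
    by apply: cyc_exit; rewrite /output_step E.
  by rewrite upd_same.
rewrite /t wtape_left in TY.
have E : heads T output_tape = Some b by rewrite /heads TY.
pose T1 := write_all (output_step (heads T)).2 T.
have T1E : T1 = upd output_tape (swrite (Some b, MoveLeft) (T output_tape))
    (upd (inl ord0) (swrite (Some b, MoveLeft) (T (inl ord0))) T).
  by rewrite /T1 /output_step E -write_at_tapes.
have T1Y : T1 output_tape = swrite (shead (wtape w (b :: suf)), MoveLeft) (wtape w (b :: suf)).
  by rewrite T1E upd_same TY.
have T10 : reads (stail (T1 (inl ord0)).2) (b :: v).
  by rewrite T1E upd_other // upd_same.
have [T' run rd] := IH _ _ _ T1Y T10.
exists T'; last by rewrite cat_rcons.
rewrite size_rcons; apply: cyc_more => //.
by rewrite /output_step E.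
Qed.

Lemma runs_output A X st : exists2 T',
  runs tm_output (tapes A X st) T' (size (out st) + 9)
  & reads (T' (inl ord0)).2 (out st).
Proof.
set T := tapes A X st; set t := swrite (None, MoveLeft) (wtape (out st) [::]).
have run1 : runs (tm_back output_tape) T (upd output_tape t T) 1 by exact: runs_step.
(* This blank ends the output, whatever stands to its right. *)
have run2 := runs_step (inl ord0) (fun=> (None, MoveLeft)) (upd output_tape t T) 0.
set T2 := upd (inl ord0) _ _ in run2.
have T2Y : T2 output_tape = t by rewrite /T2 upd_other // upd_same.
have T20 : reads (stail (T2 (inl ord0)).2) [::] by rewrite /T2 upd_same.
have [T' run rd] := runs_output_loop T2Y T20.
exists T'; last by rewrite cats0 in rd.
by apply: (runs_seq (runs_seq run1 run2 (leqnn _)) run); lia.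
Qed.

Definition tm_stream (ps : seq pass) : tm I :=
  tm_seq (tm_seq tm_copy (tm_rewind input_tape)) (tm_seq (tm_passes ps) tm_output).

Lemma runs_stream (ps : seq pass) :
  exists2 B : nat -> nat, poly_bounded B & forall l s A,
    A ord0 = (l, nth None s) -> exists2 T',
    runs (tm_stream ps) (tapes A (wtape [::] [::]) (Store (fun=> 0) [::])) T'
      (B (size (blank_free_prefix s)))
    & reads (T' (inl ord0)).2 (run_passes ps (blank_free_prefix s)).
Proof.
have [B polyB HB] := runs_passes ps (poly_bounded_const 0).
exists (fun n => n + n + B n + B n + 30); first by solve_poly.
move=> l s A A0; set w := blank_free_prefix s.
have [A' run1] := runs_copy (Store (fun=> 0) [::]) [::] A0.
have [run3 leo] := HB w A' (Store (fun=> 0) [::]) (fun=> leqnn _) (leqnn _).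
have := @runs_rewind _ input_tape (tapes A' (wtape w [::]) (Store (fun=> 0) [::]))
  w [::] (size w + 4) erefl (leqnn _).
rewrite tapes_input cats0 => run2.
have [T' run4 rd] := runs_output A' (wtape [::] w) (foldl (run_pass w) (Store (fun=> 0) [::]) ps).
exists T' => //.
apply: (runs_seq (runs_seq run1 run2 (leqnn _)) (runs_seq run3 run4 (leqnn _))).
rewrite -/w; lia.
Qed.

End Machine.
End Scan.
End Stream.

(** * Closure of polynomial-time functions *)

(** Every machine has at least two tapes, so two inputs fit on those of [M] and all auxiliary tapes
    start blank. *)
Lemma initial_tapes (M : machine) (J : finType) (P : tm ('I_(extra_tapes M).+2 + J))
    (inputs : seq word) :
  size inputs <= 2 ->
  forall i, stape_of ((initial (machine_of P) inputs).2 (tape_ord i))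
    = join_tapes (fun j => stape_of ((initial M inputs).2 j))
        (fun=> wtape [::] [::]) i.
Proof.
move=> le [j|j] /=; rewrite !ffunE //=.
by rewrite nth_default //; apply: leq_trans le _.
Qed.

Lemma machine_of_computes (M : machine) (J : finType)
    (P : tm ('I_(extra_tapes M).+2 + J)) inputs out T' n :
  size inputs <= 2 ->
  runs P (join_tapes (fun j => stape_of ((initial M inputs).2 j))
            (fun=> wtape [::] [::])) T' n ->
  reads (T' (inl ord0)).2 out ->
  computes_within (machine_of P) inputs out n.
Proof.
move=> le run rd.
have [E HT] := @machine_of_run M J P _ _ _ _ (initial (machine_of P) inputs) run
  erefl (initial_tapes P le).
split; first by rewrite /= E.
rewrite -tape_ord0; apply: reads_blank_free_prefix.
by rewrite -HT in rd.
Qed.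

Lemma computes_within_reads (M : machine) inputs out t :
  computes_within M inputs out t ->
  reads (stape_of ((iter t (@step M) (initial M inputs)).2 ord0)).2 out.
Proof. by case=> _ <-; exact: reads_nth. Qed.

Lemma polytime1_stream (R Q : finType) (delta : Q -> bool -> Q) (q0 : Q)
    (ps : seq (pass R Q)) f :
  polytime1 f -> polytime1 (fun x => run_passes delta q0 ps (f x)).
Proof.
move=> [M [a [d comp]]].
have [B [c [e leB]] HB] := runs_stream delta q0 (extra_tapes M) ps.
pose t n := a * n ^ d + a.
have polyt : poly_bounded t by rewrite /t; solve_poly.
(* [B] need not be monotone; its bound is, which allows [size (f x)] to be replaced by its estimate
   from [size_output]. *)
pose b n := c * (n + 2 * t n).+1 ^ e.
have polyb : poly_bounded b.
  apply: (@poly_bounded_comp (fun m => c * m.+1 ^ e)); last by solve_poly.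
  by exists c, e.
have [a' [d' le]] : exists a' d', forall n, t n + b n + 3 <= a' * n ^ d' + a'.
  by apply: poly_boundedE; solve_poly.
pose P := tm_seq (subroutine M (option (option R)))
  (tm_stream delta q0 (extra_tapes M) ps).
exists (machine_of P), a', d' => x; have compx := comp x.
have := run_subroutine (fun _ : option (option R) => wtape [::] [::]) compx.1.
set c1 := iter _ _ _ in compx *; set A := fun j => stape_of (c1.2 j) => run1.
have [T' run2 rd] := HB (A ord0).1 (c1.2 ord0).2 A erefl.
rewrite compx.2 in run2 rd.
apply: (@machine_of_computes _ _ _ _ _ T') rd => //.
have Ej : tapes A (wtape [::] [::]) (Store (fun=> 0) [::])
  = join_tapes A (fun _ : option (option R) => wtape [::] [::]).
  by apply: functional_extensionality => -[|[[]|]].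
rewrite Ej in run2.
apply: (runs_seq run1 run2); apply: leq_trans (le (size x)).
have lef : size (f x) <= size x + 2 * t (size x) by have := size_output compx.
have : B (size (f x)) <= b (size x).
  apply: leq_trans (leB _) _; rewrite leq_mul2l; apply/orP; right.
  by case: (e) => // e'; rewrite leq_exp2r.
rewrite /t; lia.
Qed.

(** * Truncating a solution word on its own tape *)

Section Half.

Variable k : nat.
Let I := ('I_k.+2 + unit)%type.
Let z : I := inl (lift ord0 ord0).
Let aux : I := inr tt.

(* Marks every second letter of tape 1 on the auxiliary tape. *)
Definition tm_mark : tm I :=
  @Tm I bool false (fun b sy =>
    if sy z is None then (None, noop sy) else
    if b then (Some false, touch (at_tapes z (sy z, MoveRight) aux (Some true, MoveRight)) sy)
    else (Some true, touch (at_tape z (sy z, MoveRight)) sy)).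

(** The state [b] records an unpaired letter already passed, which counts together with those to
    come. *)
Lemma runs_mark (b : bool) T pre suf c :
  T z = wtape pre suf -> T aux = wtape (nseq c true) [::] ->
  @run_from I tm_mark b T
    (upd aux (wtape (nseq (c + (size suf + b)./2) true) [::])
      (upd z (wtape (pre ++ suf) [::]) T)) (size suf).+1.
Proof.
elim: suf b T pre c => [|x suf IH] b T pre c Tz Ta.
  have -> : c + (size (@nil bool) + b)./2 = c by case: b; rewrite ?addn0.
  rewrite cats0 -Tz upd_id -Ta upd_id -{2}[T]write_noop.
  by apply: RunExit; rewrite /= /heads Tz.
have hz : heads T z = Some x by rewrite /heads Tz.
case: b.
  pose act := touch (at_tapes z (Some x, MoveRight) aux (Some true, MoveRight)) (heads T).
  apply: (@RunMore I tm_mark _ false _ _ act); first by rewrite /= hz.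
  rewrite /act write_at_tapes // Tz Ta !wtape_right -nseq_rcons.
  set T1 := upd aux _ _.
  have T1z : T1 z = wtape (rcons pre x) suf by rewrite /T1 upd_other // upd_same.
  have T1a : T1 aux = wtape (nseq c.+1 true) [::] by rewrite /T1 upd_same.
  have := IH false _ _ _ T1z T1a.
  rewrite /T1 (@upd_comm _ z) // !upd_upd cat_rcons addn0.
  have -> : (size (x :: suf) + true)./2 = (size suf)./2.+1.
    by rewrite -[nat_of_bool true]/1 addn1.
  by rewrite addnS.
pose act := touch (at_tape z (Some x, MoveRight)) (heads T).
apply: (@RunMore I tm_mark _ true _ _ act); first by rewrite /= hz.
rewrite /act write_at_tape Tz wtape_right.
set T1 := upd z _ _.
have T1z : T1 z = wtape (rcons pre x) suf by rewrite /T1 upd_same.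
have T1a : T1 aux = wtape (nseq c true) [::] by rewrite /T1 upd_other.
have := IH true _ _ _ T1z T1a.
by rewrite /T1 upd_upd cat_rcons -[nat_of_bool true]/1 addn1 addn0.
Qed.

Definition erase_step (sy : I -> symbol) : bool * (I -> symbol * move) :=
  if sy aux is Some _
  then (true, touch (at_tapes z (None, MoveLeft) aux (None, MoveLeft)) sy)
  else (false, touch (at_tape z (None, Stay)) sy).

(** The scanned cell is treated as blank already, since every step blanks it, the exit step
    included. The loop starts on the blank after the word, so after [c > 0] marks the head stands on
    the last letter to be removed. *)
Lemma runs_erase T w c :
  c <= size w -> swrite (None, Stay) (T z) = wtape w [::] ->
  T aux = swrite (None, MoveLeft) (wtape (nseq c true) [::]) ->
  exists t, runs (cyc erase_step) T
    (upd aux t (upd z (wtape (take (size w - c) w) [::]) T)) c.+1.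
Proof.
have base w0 T0 : swrite (None, Stay) (T0 z) = wtape w0 [::] ->
    T0 aux = swrite (None, MoveLeft) (wtape [::] [::]) ->
    runs (cyc erase_step) T0 (upd aux (T0 aux) (upd z (wtape w0 [::]) T0)) 1.
  move=> Tz Ta; have E : heads T0 aux = None by rewrite /heads Ta.
  rewrite -Tz.
  rewrite -[in X in runs _ _ X _](_ : upd z (swrite (None, Stay) (T0 z)) T0 aux = T0 aux);
    last by rewrite upd_other.
  rewrite upd_id -write_at_tape.
  have -> : touch (at_tape z (None, Stay)) (heads T0) = (erase_step (heads T0)).2.
    by rewrite /erase_step E.
  by apply: cyc_exit; rewrite /erase_step E.
elim/last_ind: w c T => [|w b IH] [|c] T le Tz Ta //.
- by exists (T aux); apply: base.
- by exists (T aux); rewrite subn0 take_size; apply: base.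
rewrite nseq_rcons wtape_erase in Ta; rewrite size_rcons ltnS in le.
have E : heads T aux = Some true by rewrite /heads Ta.
pose T1 := upd aux (swrite (None, MoveLeft) (T aux)) (upd z (swrite (None, MoveLeft) (T z)) T).
have T1z : swrite (None, Stay) (T1 z) = wtape w [::].
  rewrite /T1 upd_other // upd_same; case: (T z) Tz => l r [El Er].
  have Er' m : r m.+1 = None.
    by have := congr1 (fun s : stream => s m.+1) Er.
  apply: stape_eq => m; rewrite /= ?El /stail ?rev_rcons //.
  by case: m => [|[|m]] //=; rewrite /stail ?Er' ?nth_nil.
have T1a : T1 aux = swrite (None, MoveLeft) (wtape (nseq c true) [::]).
  by rewrite /T1 upd_same Ta; apply: stape_eq => // -[|[|[]]].
have [t run] := IH _ _ le T1z T1a.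
exists t; apply: cyc_more; rewrite /erase_step E //= write_at_tapes // -/T1.
rewrite size_rcons subSS -cats1 takel_cat ?leq_subr //.
by move: run; rewrite {2}/T1 (@upd_comm _ z) // !upd_upd.
Qed.

Definition tm_half : tm I :=
  tm_seq (tm_seq tm_mark (tm_back aux))
    (tm_seq (tm_seq (cyc erase_step) (tm_rewind z))
      (tm_seq (tm_step z (fun=> (None, MoveRight)))
              (tm_step z (fun=> (None, MoveRight))))).

(** On two halves of equal length this is the first half without its bits b and c. The subtraction
    reflects the machine, which erases one letter at the right end per mark. *)
Definition half_drop2 (w : word) : word := drop 2 (take (size w - (size w)./2) w).

(** The new blank merges with the blank half-line on the left, so the result is again an initial
    tape. *)
Lemma wtape_drop w :
  swrite (None, MoveRight) (wtape [::] w) = wtape [::] (behead w).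
Proof. by apply: stape_eq => m /=; [case: m => //= m; rewrite ?nth_nil|case: w => [|b w] //=; case: m]. Qed.

Lemma runs_half T w :
  T z = wtape [::] w -> T aux = wtape [::] [::] ->
  exists t, runs tm_half T (upd aux t (upd z (wtape [::] (half_drop2 w)) T)) (4 * size w + 30).
Proof.
move=> Tz Ta.
have run1 : runs tm_mark T _ _ := runs_mark false (c := 0) Tz Ta.
rewrite add0n addn0 cat0s in run1.
set T1 := upd aux _ _ in run1.
have run2 := runs_step aux (fun a => (a, MoveLeft)) T1 0.
set T2 := upd aux _ T1 in run2.
have T2z : swrite (None, Stay) (T2 z) = wtape w [::].
  rewrite /T2 upd_other // /T1 upd_other // upd_same.
  exact: (swrite_same (wtape w [::])).
have T2a : T2 aux = swrite (None, MoveLeft) (wtape (nseq (size w)./2 true) [::]).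
  by rewrite /T2 upd_same /T1 upd_same.
have le : (size w)./2 <= size w by lia.
have [t run3] := runs_erase le T2z T2a.
set T3 := upd aux t _ in run3; set v := take _ _ in T3 run3.
have T3z : T3 z = wtape v [::] by rewrite /T3 upd_other // upd_same.
have run4 := runs_rewind T3z (leqnn _).
set T4 := upd z _ T3 in run4.
have run5 := runs_step z (fun=> (None, MoveRight)) T4 0.
have T4z : T4 z = wtape [::] v by rewrite /T4 upd_same cats0.
rewrite T4z wtape_drop in run5.
set T5 := upd z _ T4 in run5.
have run6 := runs_step z (fun=> (None, MoveRight)) T5 0.
have T5z : T5 z = wtape [::] (behead v) by rewrite /T5 upd_same.
rewrite T5z wtape_drop in run6.
exists t.
have -> : upd aux t (upd z (wtape [::] (half_drop2 w)) T)
    = upd z (wtape [::] (behead (behead v))) T5.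
  rewrite /T5 /T4 /T3 !upd_upd (@upd_comm _ z) // upd_upd /T2 /T1 !upd_upd.
  rewrite (@upd_comm _ z aux) // !upd_upd.
  by rewrite /half_drop2 -/v -!drop1 drop_drop.
apply: (runs_seq (runs_seq run1 run2 (leqnn _)) (runs_seq
  (runs_seq run3 run4 (leqnn _)) (runs_seq run5 run6 (leqnn _)) (leqnn _))).
have : size v <= size w by rewrite size_take; case: ifP; lia.
lia.
Qed.

End Half.

Lemma polytime2_half g :
  polytime2 g -> polytime2 (fun x y => g x (half_drop2 y)).
Proof.
move=> [M [a [d comp]]].
have [a' [d' le]] : exists a' d', forall n,
    4 * n + 40 + (a * n ^ d + a) <= a' * n ^ d' + a'.
  by apply: poly_boundedE; solve_poly.
exists (machine_of (tm_seq (tm_half (extra_tapes M)) (subroutine M unit))), a', d' => x y.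
have compx := comp x (half_drop2 y).
set T := join_tapes (fun j => stape_of ((initial M [:: x; y]).2 j))
  (fun _ : unit => wtape [::] [::]).
have Tz : T (inl (lift ord0 ord0)) = wtape [::] y by rewrite /T /= ffunE.
have Ta : T (inr tt) = wtape [::] [::] by [].
have [t run1] := runs_half Tz Ta.
have run2 := run_subroutine (fun _ : unit => t) compx.1.
set T1 := join_tapes _ _ in run2.
(* Only the tapes of [M] have to be initial; [run_subroutine] allows any content on the auxiliary
   tape. *)
have ET : T1 = upd (inr tt) t (upd (inl (lift ord0 ord0)) (wtape [::] (half_drop2 y)) T).
  apply: functional_extensionality => -[j|[]]; last by rewrite upd_same.
  rewrite upd_other // /upd -[inl j == _]/(j == lift ord0 ord0).
  case: eqP => [->|ne]; rewrite /= !ffunE //.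
  by case: j ne => -[|[|j]] lt ne //=; case: ne; exact: val_inj.
rewrite ET in run2.
apply: machine_of_computes => //; first apply: (runs_seq run1 run2).
  apply: leq_trans (le _).
  have lh : size (half_drop2 y) <= size y.
    by rewrite /half_drop2 size_drop size_take; case: ifP; lia.
  have : a * (size x + size (half_drop2 y)) ^ d <= a * (size x + size y) ^ d.
    rewrite leq_mul2l; apply/orP; right; case: (d) => // e.
    by rewrite leq_exp2r // leq_add2l.
  lia.
exact: computes_within_reads compx.
Qed.

(** * The reduction on circuits *)

Arguments wire_values : simpl never.

Lemma wire_values_cat v gs gs' :
  wire_values v (gs ++ gs') = wire_values (wire_values v gs) gs'.
Proof. exact: foldl_cat. Qed.

Lemma wire_values_cons v g gs :
  wire_values v (g :: gs) = wire_values (rcons v (gate_value v g)) gs.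
Proof. by []. Qed.

Lemma size_wire_values v gs : size (wire_values v gs) = size v + size gs.
Proof.
elim: gs v => [|g gs IH] v; first by rewrite addn0.
by rewrite wire_values_cons IH size_rcons addSnnS.
Qed.

Lemma nth_wire_values v gs i :
  i < size v -> nth false (wire_values v gs) i = nth false v i.
Proof.
elim: gs v => [|g gs IH] v //= lt.
by rewrite wire_values_cons IH ?size_rcons ?leqW // nth_rcons lt.
Qed.

Definition shift_gate (k : nat) (g : gate) : gate :=
  match g with
  | Const b => Const b
  | Not i => Not (i + k)
  | And i j => And (i + k) (j + k)
  | Or i j => Or (i + k) (j + k)
  end.

Lemma nth_shift (pre v : seq bool) i :
  nth false (pre ++ v) (i + size pre) = nth false v i.
Proof. by rewrite nth_cat ltnNge leq_addl /= addnK. Qed.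

(** A circuit shifted by [size pre] ignores the wires in [pre]. This places S behind the inputs b
    and c, and P behind all wires of S. *)
Lemma wire_values_shift pre v gs :
  wire_values (pre ++ v) (map (shift_gate (size pre)) gs)
  = pre ++ wire_values v gs.
Proof.
elim: gs v => [|g gs IH] v //=; rewrite !wire_values_cons -IH -rcons_cat.
by congr (wire_values (rcons _ _) _); case: g => [b|i|i j|i j] //=; rewrite !nth_shift.
Qed.

Lemma gates_ok_cat w gs gs' :
  gates_ok w (gs ++ gs') = gates_ok w gs && gates_ok (w + size gs) gs'.
Proof.
elim: gs w => [|g gs IH] w /=; first by rewrite addn0.
by rewrite IH addSnnS andbA.
Qed.

Lemma gates_ok_shift k w gs :
  gates_ok w gs -> gates_ok (w + k) (map (shift_gate k) gs).
Proof.
elim: gs w => [|g gs IH] w //= /andP[ok oks]; rewrite -addSn IH // andbT.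
by case: g ok => //= i; rewrite ?ltn_add2r // => j; rewrite !ltn_add2r.
Qed.

(** A conjunction of a wire with itself serves as identity gate. Copying brings the outputs of S to
    consecutive wires, where P expects its inputs. *)
Definition copy_gates (k : nat) (os : seq nat) : seq gate :=
  [seq And (o + k) (o + k) | o <- os].

Lemma gates_ok_copy k w os :
  all (fun o => o < w) os -> gates_ok (w + k) (copy_gates k os).
Proof.
elim: os w => [|o os IH] w //= /andP[lt lts].
rewrite !ltn_add2r lt /= -addSn IH //.
by apply: sub_all lts => i; lia.
Qed.

Lemma copyP v k os :
  all (fun o => o + k < size v) os ->
  wire_values v (copy_gates k os) = v ++ [seq nth false v (o + k) | o <- os].
Proof.
elim: os v => [|o os IH] v /=; first by rewrite cats0.
move=> /andP[lt lts]; rewrite wire_values_cons IH /= ?andbb; last first.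
  by apply: sub_all lts => i; rewrite size_rcons; lia.
rewrite -cats1 -catA /=; congr (_ ++ _ :: _).
by apply/eq_in_map => i /(allP lts) lti; rewrite nth_cat lti.
Qed.

(* Wire [W] says whether a difference was found so far. *)
Fixpoint compare_gates (K W i : nat) (qs : seq nat) : seq gate :=
  if qs is q :: qs' then
    [:: Or (q + K) (i + 2); And (q + K) (i + 2); Not (W + 2);
        And (W + 1) (W + 3); Or W (W + 4)]
    ++ compare_gates K (W + 5) i.+1 qs'
  else [::].

Lemma size_compare_gates K W i qs : size (compare_gates K W i qs) = 5 * size qs.
Proof. by elim: qs W i => //= q qs IH W i; rewrite IH; lia. Qed.

Lemma gates_ok_compare K W i qs :
  all (fun q => q + K <= W) qs -> i + size qs < W ->
  gates_ok W.+1 (compare_gates K W i qs).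
Proof.
elim: qs W i => //= q qs IH W i /andP[le les] lt.
rewrite (_ : W.+1.+1.+4 = (W + 5).+1) ?IH; try lia.
by apply: sub_all les => j; lia.
Qed.

(** Of the five gates per output, on wires [W + 1] to [W + 5], four compute an exclusive or and the
    last adds it to the flag, which thus advances by 5. The offset 2 in [i + 2] skips b and c. *)
Lemma compareP K W i qs v :
  size v = W.+1 -> all (fun q => q + K <= W) qs -> i + size qs < W ->
  exists2 e, wire_values v (compare_gates K W i qs) = v ++ e &
    nth false (v ++ e) (W + 5 * size qs)
    = nth false v W || ([seq nth false v (q + K) | q <- qs]
                        != [seq nth false v (j + 2) | j <- iota i (size qs)]).
Proof.
elim: qs W i v => [|q qs IH] W i v sv /=.
  by exists [::]; rewrite ?cats0 ?muln0 ?addn0 ?orbF.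
move=> /andP[le les] lt.
have old j l : j <= W -> nth false (v ++ l) j = nth false v j.
  by move=> lej; rewrite nth_cat sv ltnS lej.
have new j l : nth false (v ++ l) (W + j.+1) = nth false l j.
  by rewrite nth_cat sv addnS ltnS ltnNge leq_addr /= subSS addKn.
set a := nth false v (q + K); set x := nth false v (i + 2).
pose e := [:: a || x; a && x; ~~ (a && x); (a || x) && ~~ (a && x);
              nth false v W || (a || x) && ~~ (a && x)].
have step : wire_values v [:: Or (q + K) (i + 2); And (q + K) (i + 2); Not (W + 2);
    And (W + 1) (W + 3); Or W (W + 4)] = v ++ e.
  rewrite !wire_values_cons /= -!cats1 -!catA /= !new /=.
  by rewrite !old //; lia.
set gs := compare_gates _ _ _ _.
rewrite -[X in wire_values v X]/([:: Or (q + K) (i + 2); And (q + K) (i + 2);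
  Not (W + 2); And (W + 1) (W + 3); Or W (W + 4)] ++ gs) wire_values_cat step.
have sve : size (v ++ e) = (W + 5).+1 by rewrite size_cat sv /=; lia.
have les' : all (fun q => q + K <= W + 5) qs by apply: sub_all les => j; lia.
have [|e' -> H] := IH (W + 5) i.+1 (v ++ e) sve les'; first by lia.
exists (e ++ e'); first by rewrite catA.
rewrite catA mulnS addnA H (new 4) /= -/a -/x.
have -> : [seq nth false (v ++ e) (j + K) | j <- qs] = [seq nth false v (j + K) | j <- qs].
  by apply/eq_in_map => j /(allP les) lej; rewrite old.
have -> : [seq nth false (v ++ e) (j + 2) | j <- iota i.+1 (size qs)]
  = [seq nth false v (j + 2) | j <- iota i.+1 (size qs)].
  by apply/eq_in_map => j; rewrite mem_iota => lej; rewrite old //; lia.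
rewrite eqseq_cons (negb_and (a == x)) orbA; congr (_ || _); congr (_ || _).
by case: (a); case: (x).
Qed.

(* Wires 0 and 1 carry the two extra inputs b and c, wire [W] the sink flag. *)
Definition flag_gates (W : nat) : seq gate :=
  [:: And 0 W; Or 1 (W + 1); Not (W + 2); And 0 (W + 3); Not (W + 4)].

(** Wire [W + 2] is the first bit of the category; wires [W + 4] and [W + 5] select S(x) and x
    respectively. *)
Lemma flagP W v :
  size v = W.+1 -> 1 < W ->
  let b := nth false v 0 in let c := nth false v 1 in
  let sink := nth false v W in let m := b && ~~ (c || b && sink) in
  wire_values v (flag_gates W)
  = v ++ [:: b && sink; c || b && sink; ~~ (c || b && sink); m; ~~ m].
Proof.
move=> sv lt b c sink m.
have old j l : j <= W -> nth false (v ++ l) j = nth false v j.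
  by move=> lej; rewrite nth_cat sv ltnS lej.
have new j l : nth false (v ++ l) (W + j.+1) = nth false l j.
  by rewrite nth_cat sv addnS ltnS ltnNge leq_addr /= subSS addKn.
rewrite !wire_values_cons /= -!cats1 -!catA /= !new /=.
by rewrite !old // ltnW.
Qed.

(** A multiplexer with three gates per bit. The multiple 3i is spelled as repeated addition because
    the streaming program forms an address by writing a unary register several times. *)
Fixpoint select_gates (K W i m : nat) : seq gate :=
  if m is m'.+1 then
    [:: And (W + 4) (K + i); And (W + 5) (i + 2);
        Or (W + (i + (i + (i + 6)))) (W + (i + (i + (i + 7))))]
    ++ select_gates K W i.+1 m'
  else [::].

Lemma size_select_gates K W i m : size (select_gates K W i m) = 3 * m.
Proof. by elim: m i => //= m IH i; rewrite IH; lia. Qed.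

Lemma gates_ok_select K W i m :
  K + (i + m) <= W -> i + m < W ->
  gates_ok (W + (i + (i + (i + 6)))) (select_gates K W i m).
Proof.
elim: m i => //= m IH i le lt.
rewrite (_ : (W + (i + (i + (i + 6)))).+3 = W + (i.+1 + (i.+1 + (i.+1 + 6)))); last lia.
rewrite IH; lia.
Qed.

Lemma selectP K W i m v :
  size v = W + (i + (i + (i + 6))) -> K + (i + m) <= W -> i + m < W ->
  exists2 e, wire_values v (select_gates K W i m) = v ++ e &
    [seq nth false (v ++ e) (W + (j + (j + (j + 8)))) | j <- iota i m]
    = [seq nth false v (W + 4) && nth false v (K + j)
           || nth false v (W + 5) && nth false v (j + 2) | j <- iota i m].
Proof.
elim: m i v => [|m IH] i v sv le lt; first by exists [::]; rewrite ?cats0.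
rewrite /=; set gs := select_gates _ _ _ _.
set u := nth false v (W + 4); set u' := nth false v (W + 5).
have old j l : j < W + 6 -> nth false (v ++ l) j = nth false v j.
  by move=> lej; rewrite nth_cat sv; case: ltnP => //; lia.
have new j l : nth false (v ++ l) (W + (i + (i + (i + (6 + j))))) = nth false l j.
  rewrite nth_cat sv; case: ltnP => [|_]; first by lia.
  by congr nth; lia.
set e := [:: u && nth false v (K + i); u' && nth false v (i + 2);
             u && nth false v (K + i) || u' && nth false v (i + 2)].
have step : wire_values v [:: And (W + 4) (K + i); And (W + 5) (i + 2);
    Or (W + (i + (i + (i + 6)))) (W + (i + (i + (i + 7))))] = v ++ e.
  rewrite !wire_values_cons /= -!cats1 -!catA /= (new 0) (new 1) /=.
  by rewrite !old //; lia.
rewrite -[X in wire_values v X]/([:: And (W + 4) (K + i); And (W + 5) (i + 2);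
  Or (W + (i + (i + (i + 6)))) (W + (i + (i + (i + 7))))] ++ gs) wire_values_cat step.
have sve : size (v ++ e) = W + (i.+1 + (i.+1 + (i.+1 + 6))).
  by rewrite size_cat sv /=; lia.
have [||e' -> H] := IH i.+1 (v ++ e) sve; try lia.
exists (e ++ e'); first by rewrite catA.
rewrite catA [LHS]/= H [RHS]/=; congr cons.
  by rewrite -catA (new 2).
by apply/eq_in_map => j; rewrite mem_iota => lej; rewrite !old //; lia.
Qed.

(** Evaluation on plain words, so that circuits whose sizes are equal only by a proof can be
    compared. *)
Definition run_circuit (gs : seq gate) (os : seq nat) (v : seq bool) : seq bool :=
  map (nth false (wire_values v gs)) os.

Section Pigeon.

Variables (n : nat) (S P : circuit n n).

(* Wire [i] of [P] becomes wire [i + P_offset]; its inputs are the copied outputs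
   of [S]. *)
Definition P_offset : nat := n + (2 + size (gates S)).
Definition first_flag : nat := P_offset + (n + size (gates P)).
Definition sink_flag : nat := first_flag + 5 * n.

(** The constant occupies wire [first_flag]: no difference is known before the first comparison. *)
Definition h_gates : seq gate :=
  map (shift_gate 2) (gates S) ++ copy_gates 2 (outputs S)
  ++ map (shift_gate P_offset) (gates P) ++ [:: Const false]
  ++ compare_gates P_offset first_flag 0 (outputs P)
  ++ flag_gates sink_flag ++ select_gates P_offset sink_flag 0 n.

Definition h_outputs : seq nat :=
  sink_flag + 2 :: [seq sink_flag + (j + (j + (j + 8))) | j <- iota 0 n].

Lemma size_h_outputs : size h_outputs == n.+1.
Proof. by rewrite /= size_map size_iota. Qed.

Lemma h_gates_wf : gates_ok (1 + n.+1) h_gates.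
Proof.
have wfS := outputs_wf S; have wfP := outputs_wf P.
have wP : all (fun q => q + P_offset <= first_flag) (outputs P).
  by apply: sub_all wfP => q; rewrite /first_flag; lia.
rewrite /h_gates !gates_ok_cat !size_map size_tuple size_compare_gates size_tuple.
have -> : 1 + n.+1 = n + 2 by lia.
rewrite gates_ok_shift ?gates_wf //.
have -> : n + 2 + size (gates S) = n + size (gates S) + 2 by lia.
rewrite gates_ok_copy //.
have -> : n + size (gates S) + 2 + n = n + P_offset by rewrite /P_offset; lia.
rewrite gates_ok_shift ?gates_wf //.
rewrite addn1 (_ : n + P_offset + size (gates P) = first_flag); last by rewrite /first_flag; lia.
rewrite gates_ok_compare ?size_tuple //; last by rewrite /first_flag /P_offset; lia.
rewrite -[first_flag.+1 + 5 * n]/(sink_flag.+1).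
rewrite (_ : sink_flag.+1 + size (flag_gates sink_flag) = sink_flag + (0 + (0 + (0 + 6))));
  last by rewrite /=; lia.
rewrite gates_ok_select /=; rewrite /sink_flag /first_flag /P_offset; lia.
Qed.

Lemma h_outputs_wf : all (fun i => i < 1 + n.+1 + size h_gates) h_outputs.
Proof.
have -> : 1 + n.+1 + size h_gates = sink_flag + 6 + 3 * n.
  rewrite /h_gates !size_cat !size_map size_compare_gates.
  rewrite size_select_gates !size_tuple /= /sink_flag /first_flag /P_offset; lia.
rewrite /=; apply/andP; split; first by lia.
by apply/allP => _ /mapP[j + ->]; rewrite mem_iota; lia.
Qed.

Lemma run_h b c x : size x = n ->
  let y := run_circuit (gates S) (outputs S) x in
  let c' := c || b && (run_circuit (gates P) (outputs P) y != x) in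
  run_circuit h_gates h_outputs (b :: c :: x)
  = c' :: (if b && ~~ c' then y else x).
Proof.
have lt2 : 1 < sink_flag by rewrite /sink_flag /first_flag /P_offset; lia.
have le3 : P_offset + (0 + n) <= sink_flag by rewrite /sink_flag /first_flag; lia.
have lt3 : 0 + n < sink_flag by rewrite /sink_flag /first_flag /P_offset; lia.
move=> sx y; set sink := (_ != _) => c'.
have wfS := outputs_wf S; have wfP := outputs_wf P.
have wS : all (fun o => o + 2 < P_offset) (outputs S).
  by apply: sub_all wfS => o; rewrite /P_offset; lia.
have sy : size y = n by rewrite size_map size_tuple.
pose V1 := [:: b; c] ++ wire_values x (gates S).
have sV1 : size V1 = P_offset by rewrite size_cat size_wire_values sx /P_offset /=; lia.
(* The word y is at once the copied output of S and the input part of P, so it occurs only once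
   among the wires. *)
pose V3 := V1 ++ wire_values y (gates P).
have sV3 : size V3 = first_flag by rewrite size_cat size_wire_values sV1 sy.
have xV t j : j < n -> nth false (V1 ++ t) (j + 2) = nth false x j.
  move=> lt; rewrite /V1 -catA (nth_shift [:: b; c]) nth_cat size_wire_values sx ifT.
    by rewrite nth_wire_values ?sx.
  by lia.
have yV t j : j < n -> nth false (V3 ++ t) (P_offset + j) = nth false y j.
  move=> lt; rewrite /V3 -catA addnC -sV1 nth_shift nth_cat size_wire_values sy ifT.
    by rewrite nth_wire_values ?sy.
  by lia.
pose V4 := V3 ++ [:: false].
have sV4 : size V4 = first_flag.+1 by rewrite size_cat sV3 addn1.
have wP : all (fun q => q + P_offset <= first_flag) (outputs P).
  by apply: sub_all wfP => q; rewrite /first_flag; lia.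
have lt1 : 0 + size (outputs P) < first_flag.
  by rewrite size_tuple /first_flag /P_offset; lia.
have [e1 E1 He1] := compareP sV4 wP lt1.
pose V5 := V4 ++ e1.
have sV5 : size V5 = sink_flag.+1.
  by rewrite /V5 -E1 size_wire_values sV4 size_compare_gates size_tuple.
have flag : nth false V5 sink_flag = sink.
  rewrite size_tuple in He1; rewrite /V5 He1.
  rewrite {1}/V4 nth_cat sV3 ltnn subnn /=; congr (_ != _).
    apply/eq_in_map => q /(allP wfP) ltq; rewrite /V4 nth_cat sV3 ifT.
      by rewrite /V3 -sV1 nth_shift.
    by rewrite /first_flag; lia.
  rewrite -[RHS](mkseq_nth false) sx; apply/eq_in_map => j; rewrite mem_iota => ltj.
  by rewrite /V4 /V3 -catA xV.
have V50 : nth false V5 0 = b by [].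
have V51 : nth false V5 1 = c by [].
pose flags := [:: b && sink; c'; ~~ c'; b && ~~ c'; ~~ (b && ~~ c')].
have E2 : wire_values V5 (flag_gates sink_flag) = V5 ++ flags.
  by rewrite (flagP sV5 lt2) flag V50 V51.
pose V6 := V5 ++ flags.
have sV6 : size V6 = sink_flag + (0 + (0 + (0 + 6))) by rewrite size_cat sV5 addSnnS.
have [e3 E3 He3] := selectP sV6 le3 lt3.
have EV : wire_values (b :: c :: x) h_gates = V6 ++ e3.
  rewrite /h_gates wire_values_cat -[b :: c :: x]/([:: b; c] ++ x).
  rewrite (wire_values_shift [:: b; c]) -/V1 wire_values_cat copyP; last first.
    by rewrite sV1.
  have -> : [seq nth false V1 (o + 2) | o <- outputs S] = y.
    by apply: eq_map => o; rewrite (nth_shift [:: b; c]).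
  rewrite wire_values_cat -sV1 wire_values_shift sV1 -/V3 wire_values_cat.
  have -> : wire_values V3 [:: Const false] = V4 by rewrite /V4 cats1.
  rewrite wire_values_cat E1 -/V5.
  by rewrite wire_values_cat E2 E3.
have newV6 j : nth false (V6 ++ e3) (sink_flag + j.+1) = nth false (flags ++ e3) j.
  by rewrite -catA nth_cat sV5 addnS ltnS ltnNge leq_addr /= subSS addKn.
rewrite /run_circuit EV /h_outputs /= newV6; congr cons.
rewrite -map_comp [LHS]He3.
have newV6' j : nth false V6 (sink_flag + j.+1) = nth false flags j.
  by rewrite nth_cat sV5 addnS ltnS ltnNge leq_addr /= subSS addKn.
rewrite (newV6' 3) (newV6' 4) /=.
have inV6 j : j < n -> nth false V6 (P_offset + j) = nth false y j.
  by move=> lt; rewrite /V6 /V5 -(catA V4) /V4 -(catA V3) yV.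
have inV6' j : j < n -> nth false V6 (j + 2) = nth false x j.
  by move=> lt; rewrite /V6 /V5 -(catA V4) /V4 -(catA V3) /V3 -(catA V1) xV.
rewrite -[RHS](mkseq_nth false) (_ : size _ = n); last by case: ifP.
apply/eq_in_map => j; rewrite mem_iota => /= lt; rewrite inV6 // inV6' //.
by case: (b && ~~ c'); rewrite /= ?orbF.
Qed.

End Pigeon.

Section PigeonInstance.

Variable I : sol_input.
Let n := sol_n I.

Definition p_circuit : circuit (1 + n.+1) 1 :=
  @Circuit (1 + n.+1) 1 [::] [tuple 0] isT isT.

Definition h_circuit : circuit (1 + n.+1) n.+1 :=
  @Circuit (1 + n.+1) n.+1 (h_gates (sol_S I) (sol_P I))
    (Tuple (size_h_outputs (sol_S I) (sol_P I)))
    (h_gates_wf (sol_S I) (sol_P I)) (h_outputs_wf (sol_S I) (sol_P I)).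

Definition removed : (1 + n.+1).-tuple bool := [tuple of false :: false :: sol_s I].

Lemma removed_inj : {in [:: removed] &, injective h_circuit}.
Proof. by move=> x y; rewrite !inE => /eqP-> /eqP->. Qed.

(** One removed element and m1 = 1: the size condition is 0 < 1 < 2^1. Writing the number of inputs
    as [1 + n.+1] makes the types agree by computation. *)
Definition pigeon_of : icp_input :=
  @IcpInput 1 n.+1 p_circuit h_circuit [:: removed] isT isT removed_inj.

End PigeonInstance.

(** * Unique decoding of instances *)

Definition prefix_inj (T : Type) (enc : T -> word) : Prop :=
  forall a b u v, enc a ++ u = enc b ++ v -> a = b /\ u = v.

Lemma enc_nat_inj : prefix_inj enc_nat.
Proof.
move=> a b u v; elim: a b => [|a IH] [|b] //=; first by case.
by case=> /IH[-> ->].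
Qed.

Lemma enc_seq_inj (T : Type) (enc : T -> word) :
  prefix_inj enc -> prefix_inj (enc_seq enc).
Proof.
move=> inj s t u v; rewrite /enc_seq.
elim: s t => [|a s IH] [|b t] //=; first by case.
by rewrite !rcons_cat -!catA => -[] /inj[-> /IH[-> ->]].
Qed.

Lemma enc_bits_inj : prefix_inj enc_bits.
Proof. by apply: enc_seq_inj => a b u v []. Qed.

Lemma enc_gate_inj : prefix_inj enc_gate.
Proof.
move=> [b|i|i j|i j] [b'|i'|i' j'|i' j'] u v //=.
- by case=> -> ->.
- by case=> /enc_nat_inj[-> ->].
- by case; rewrite -!catA => /enc_nat_inj[-> /enc_nat_inj[-> ->]].
- by case; rewrite -!catA => /enc_nat_inj[-> /enc_nat_inj[-> ->]].
Qed.

(** A solution refers to any input with the given encoding, not to the one that was built. The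
    conclusion compares untyped data, because the circuits and tuples of [I] and [J] have different
    types until the sizes are identified. *)
Lemma enc_icp_input_inj (I J : icp_input) :
  enc_icp_input I = enc_icp_input J ->
  [/\ icp_m1 I = icp_m1 J /\ icp_m2 I = icp_m2 J,
      gates (icp_p I) = gates (icp_p J) /\
      outputs (icp_p I) = outputs (icp_p J) :> seq nat,
      gates (icp_h I) = gates (icp_h J) /\
      outputs (icp_h I) = outputs (icp_h J) :> seq nat
    & map val (icp_Pi I) = map val (icp_Pi J)].
Proof.
rewrite /enc_icp_input /enc_circuit -!catA.
have encE m (s : seq (m.-tuple bool)) :
    enc_seq (fun x : m.-tuple bool => enc_bits x) s = enc_seq enc_bits (map val s).
  by rewrite /enc_seq -map_comp.
rewrite !encE.
move=> /enc_nat_inj[E1 /enc_nat_inj[E2]].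
move=> /(enc_seq_inj enc_gate_inj)[E3 /(enc_seq_inj enc_nat_inj)[E4]].
move=> /(enc_seq_inj enc_gate_inj)[E5 /(enc_seq_inj enc_nat_inj)[E6]].
rewrite -[LHS]cats0 -[RHS]cats0 => /(enc_seq_inj enc_bits_inj)[E7 _].
by [].
Qed.

(** * Mapping solutions back *)

Section Correct.

Variable I : sol_input.
Let n := sol_n I.
Let S x := run_circuit (gates (sol_S I)) (outputs (sol_S I)) x.
Let P x := run_circuit (gates (sol_P I)) (outputs (sol_P I)) x.
Let h x := run_circuit (h_gates (sol_S I) (sol_P I)) (h_outputs (sol_S I) (sol_P I)) x.
Let s : seq bool := sol_s I.

Let hE b c x : size x = n ->
  h [:: b, c & x] = let c' := c || b && (P (S x) != x) in
    c' :: (if b && ~~ c' then S x else x).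
Proof. exact: run_h. Qed.

Let Ps : P s = s.
Proof. by have [/(congr1 val)] := sol_source I. Qed.

Let Ss : S s <> s.
Proof. by move=> E; have [_ ne] := sol_source I; apply: ne; apply: val_inj; symmetry. Qed.

Lemma no_removed_category u :
  size u = n.+2 -> u != [:: false, false & s] ->
  h u <> h [:: false, false & s].
Proof.
case: u => [|b [|c x]] // [sx] ne; rewrite !hE ?size_tuple //=.
case: c ne => //= ne [].
case: b ne => /=; last by move=> ne _ Ex; rewrite Ex eqxx in ne.
move=> _; case: eqP => //= E _ Es; apply: Ss; rewrite -[RHS]Es; congr S.
by rewrite -E Es Ps.
Qed.

Lemma collision_sink u v :
  size u = n.+2 -> size v = n.+2 -> u != v ->
  nth false u 0 = nth false v 0 -> h u = h v ->
  P (S (drop 2 u)) <> drop 2 u.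
Proof.
case: u v => [|b [|c x]] // [|b' [|c' x']] // [sx] [sx'] ne /= Eb.
move: ne; rewrite -{}Eb drop0 !hE //=; case: b => /=; last first.
  by rewrite !orbF => ne [Ec Ex]; rewrite Ec Ex eqxx in ne.
move=> ne [Ec ES] E; rewrite -Ec E eqxx orbF in ES; rewrite E eqxx orbF in Ec.
(* By [E], x is not a sink. If c = 1, then x = x' and hence c' = 1. If c = 0, then c' = 0 and x' is
   not a sink either, so S(x) = S(x') and applying P gives x = x'. Both contradict [ne]. *)
case: c Ec ne ES => /= Ec ne ES.
  move: Ec ne; rewrite -{}ES E eqxx orbF => <-; by rewrite eqxx.
case: c' Ec ne => //= /esym/negbFE/eqP E' /eqP[].
by rewrite -E -E' ES.
Qed.

(** Unique decoding transfers the problem from [J] to the constructed instance. Solutions of the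
    first kind are excluded by [no_removed_category], so only a pair is left. *)
Lemma pigeon_solution z :
  solution InjectiveCategorizedPigeon (enc_icp_input (pigeon_of I)) z ->
  solution SinkOfLine (enc_sol_input I) (half_drop2 z).
Proof.
case=> J [/enc_icp_input_inj[[m1 m2] [gp op] [gh oh] EPi] sol].
case: J m1 m2 gp op gh oh EPi sol => m1 m2 p0 h0 Pi u1 u2 u3 /= m1E m2E.
subst m1 m2 => gp op gh oh EPi sol.
have hE0 x : val (h0 x) = h x by rewrite /= -gh -oh.
have inPi x : (x \in Pi) = (val x == [:: false, false & s]).
  by rewrite -(mem_map val_inj) -EPi inE.
case: sol => [[x [[nPi /mapP[y yPi Exy]] _]]|[x [y [[ne _ _ Ep Eh] ->]]]].
  have := congr1 val Exy; rewrite !hE0; move: yPi nPi; rewrite !inPi => /eqP-> ne E.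
  by case: (@no_removed_category (val x) _ ne); rewrite ?size_tuple.
(* Both halves have length n + 2, so the cut falls exactly between them. *)
have halfE : half_drop2 (x ++ y) = drop 2 x.
  rewrite /half_drop2 size_cat !size_tuple addnn doubleK -addnn addnK take_size_cat //.
  by rewrite size_tuple.
have sx : size (drop 2 x) == n by rewrite size_drop size_tuple subSS subSS subn0.
exists I, (Tuple sx); split=> //.
move/(congr1 val) => /=; apply: (@collision_sink x y).
- by rewrite size_tuple.
- by rewrite size_tuple.
- by apply: contra ne => /eqP/val_inj->.
- have := congr1 val Ep; rewrite /= -gp -op /=; by case.
- by have := congr1 val Eh; rewrite !hE0.
Qed.

End Correct.

(** * The reduction as a streaming program *)

(* Position in [enc_sol_input]; the flag of the circuit states is [true] in the
   second circuit. *)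
Inductive parser :=
| InSize
| AtGate of bool | AtTag of bool | AtTag2 of bool & bool | AtConst of bool
| InArg1 of bool | InArg2 of bool
| AtOutput of bool | InOutput of bool
| AtBit | InBit | AtEnd.

(** An injection into a finite type, from which the states inherit finiteness. *)
Definition parser_code (q : parser) : 'I_12 * bool * bool :=
  match q with
  | InSize => (@Ordinal 12 0 isT, false, false)
  | AtGate k => (@Ordinal 12 1 isT, k, false)
  | AtTag k => (@Ordinal 12 2 isT, k, false)
  | AtTag2 k t => (@Ordinal 12 3 isT, k, t)
  | AtConst k => (@Ordinal 12 4 isT, k, false)
  | InArg1 k => (@Ordinal 12 5 isT, k, false)
  | InArg2 k => (@Ordinal 12 6 isT, k, false)
  | AtOutput k => (@Ordinal 12 7 isT, k, false)
  | InOutput k => (@Ordinal 12 8 isT, k, false)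
  | AtBit => (@Ordinal 12 9 isT, false, false)
  | InBit => (@Ordinal 12 10 isT, false, false)
  | AtEnd => (@Ordinal 12 11 isT, false, false)
  end.
Definition parser_decode (c : 'I_12 * bool * bool) : parser :=
  let: (i, k, t) := c in
  match nat_of_ord i with
  | 0 => InSize | 1 => AtGate k | 2 => AtTag k | 3 => AtTag2 k t
  | 4 => AtConst k | 5 => InArg1 k | 6 => InArg2 k | 7 => AtOutput k
  | 8 => InOutput k | 9 => AtBit | 10 => InBit | _ => AtEnd
  end.
Lemma parser_codeK : cancel parser_code parser_decode. Proof. by case. Qed.
HB.instance Definition _ := Finite.copy parser (can_type parser_codeK).

(** The first tag bit tells binary gates from the others. [InArg2] and [InArg1] say how many
    arguments are left, so all gates end in the same way. *)
Definition parse (q : parser) (b : bool) : parser :=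
  match q, b with
  | InSize, true => InSize
  | InSize, false => AtGate false
  | AtGate k, true => AtTag k
  | AtGate k, false => AtOutput k
  | AtTag k, t => AtTag2 k t
  | AtTag2 k true, _ => InArg2 k
  | AtTag2 k false, true => InArg1 k
  | AtTag2 k false, false => AtConst k
  | AtConst k, _ => AtGate k
  | InArg2 k, true => InArg2 k
  | InArg2 k, false => InArg1 k
  | InArg1 k, true => InArg1 k
  | InArg1 k, false => AtGate k
  | AtOutput k, true => InOutput k
  | AtOutput false, false => AtGate true
  | AtOutput true, false => AtBit
  | InOutput k, true => InOutput k
  | InOutput k, false => AtOutput k
  | AtBit, true => InBit
  | AtBit, false => AtEnd
  | InBit, _ => AtBit
  | AtEnd, _ => AtEnd
  end.

(* Registers: [P_offset], the current flag wire, the index of the current output,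
   and the number being read. *)
Inductive reg := RK | RW | RI | RD.
Definition reg_code (r : reg) : bool * bool :=
  match r with
  | RK => (false, false) | RW => (false, true) | RI => (true, false) | RD => (true, true)
  end.
Definition reg_decode (c : bool * bool) : reg :=
  match c with
  | (false, false) => RK | (false, true) => RW | (true, false) => RI | (true, true) => RD
  end.
Lemma reg_codeK : cancel reg_code reg_decode. Proof. by case. Qed.
HB.instance Definition _ := Finite.copy reg (can_type reg_codeK).

#[local] Arguments scan : simpl never.
#[local] Arguments run_ops : simpl never.
#[local] Arguments run_op : simpl never.

#[local] Arguments Emit {R} b.

(* Locked, so that [run_opsE] below does not rewrite inside them. *)
HB.lock Definition emit_word (w : word) : seq (op reg) := map Emit w.

(* [(rs, c)] is the sum of the registers [rs] and of [c]. *)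
Definition addr := (seq reg * nat)%type.
HB.lock Definition emit_addr (a : addr) : seq (op reg) :=
  map (@EmitReg reg) a.1 ++ emit_word (enc_nat a.2).
HB.lock Definition emit_not (a : addr) : seq (op reg) := emit_word [:: true; false; true] ++ emit_addr a.
HB.lock Definition emit_and (a a' : addr) : seq (op reg) :=
  emit_word [:: true; true; false] ++ emit_addr a ++ emit_addr a'.
HB.lock Definition emit_or (a a' : addr) : seq (op reg) :=
  emit_word [:: true; true; true] ++ emit_addr a ++ emit_addr a'.

(** Both counters start at 2, for the wires b and c. A digit of n adds 1 to [RK] and 2 to [RW], for
    the inputs and the copies; a gate of S adds 1 to both and a gate of P adds 1 to [RW]. The word
    written after the sizes encodes the circuit without gates whose output is wire 0, which is p. *)
Definition count_em (q : parser) (b : bool) : seq (op reg) :=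
  match q, b with
  | InSize, true => [:: Emit true; Inc RK; Inc RW; Inc RW]
  | InSize, false => emit_word ([:: false; false] ++ [:: true; false; false])
  | AtGate false, true => [:: Inc RK; Inc RW]
  | AtGate true, true => [:: Inc RW]
  | _, _ => [::]
  end.

Definition wire_shift (k : bool) : addr := if k then ([:: RK], 0) else ([::], 2).

(** Each block of the old instance drives a block of gates: outputs of S the copies, outputs of P
    the comparisons, and the bits of s, merely counted, the n selections. A unary wire name is
    shifted by appending the shift before its terminator. *)
Definition gates_em (q : parser) (b : bool) : seq (op reg) :=
  match q, b with
  | AtGate _, true => [:: Emit true]
  | AtGate true, false => emit_word [:: true; false; false; false]
  | AtTag _, _ | AtTag2 _ _, _ | AtConst _, _ => [:: Emit b]
  | InArg1 _, true | InArg2 _, true => [:: Emit true]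
  | InArg1 k, false | InArg2 k, false => emit_addr (wire_shift k)
  | InOutput _, true => [:: Inc RD]
  | InOutput false, false => emit_and ([:: RD], 2) ([:: RD], 2) ++ [:: Reset RD]
  | InOutput true, false =>
      emit_or ([:: RD; RK], 0) ([:: RI], 2) ++ emit_and ([:: RD; RK], 0) ([:: RI], 2)
      ++ emit_not ([:: RW], 2) ++ emit_and ([:: RW], 1) ([:: RW], 3)
      ++ emit_or ([:: RW], 0) ([:: RW], 4) ++ [:: Reset RD; Inc RI] ++ nseq 5 (Inc RW)
  | AtOutput true, false =>
      emit_and ([::], 0) ([:: RW], 0) ++ emit_or ([::], 1) ([:: RW], 1)
      ++ emit_not ([:: RW], 2) ++ emit_and ([::], 0) ([:: RW], 3)
      ++ emit_not ([:: RW], 4) ++ [:: Reset RI]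
  | AtBit, true =>
      emit_and ([:: RW], 4) ([:: RK; RI], 0) ++ emit_and ([:: RW], 5) ([:: RI], 2)
      ++ emit_or ([:: RW; RI; RI; RI], 6) ([:: RW; RI; RI; RI], 7) ++ [:: Inc RI]
  | AtBit, false => [:: Emit false]
  | _, _ => [::]
  end.

(** The unary digits of n drive the n outputs after the first. The word written at their end closes
    the outputs, opens the single entry of Pi and encodes its leading bits 0, 0. *)
Definition outputs_em (q : parser) (b : bool) : seq (op reg) :=
  match q, b with
  | InSize, true => Emit true :: emit_addr ([:: RW; RI; RI; RI], 8) ++ [:: Inc RI]
  | InSize, false => emit_word [:: false; true; true; false; true; false]
  | AtBit, true => [:: Emit true]
  | AtBit, false => emit_word [:: false; false]
  | InBit, _ => [:: Emit b]
  | _, _ => [::]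
  end.

(** Several passes are needed because the first gates of h refer to nothing new, but those of P and
    the flags need gate counts, and the sizes and p precede h in the output. The outputs of h follow
    all its gates although n is read at the very beginning. *)
Definition pigeon_passes : seq (pass reg parser) :=
  [:: (emit_word [:: true; false; true] ++ [:: Inc RK; Inc RK; Inc RW; Inc RW], count_em);
      ([::], gates_em);
      (Reset RI :: Emit true :: emit_addr ([:: RW], 2), outputs_em)].

Definition regfile (k w i d : nat) (r : reg) : nat :=
  match r with RK => k | RW => w | RI => i | RD => d end.
HB.lock Definition st (k w i d : nat) (o : word) : store reg := Store (regfile k w i d) o.

Lemma run_ops_cat (ops ops' : seq (op reg)) s : run_ops (ops ++ ops') s = run_ops ops' (run_ops ops s).
Proof. exact: foldl_cat. Qed.

Lemma run_ops_nil s : run_ops (R := reg) [::] s = s. Proof. by []. Qed.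

Lemma run_ops_cons (o : op reg) ops s : run_ops (o :: ops) s = run_ops ops (run_op o s).
Proof. by []. Qed.

Lemma run_inc r k w i d o : run_op (Inc r) (st k w i d o) =
  match r with
  | RK => st k.+1 w i d o | RW => st k w.+1 i d o
  | RI => st k w i.+1 d o | RD => st k w i d.+1 o
  end.
Proof. by rewrite st.unlock; case: r; congr Store; apply: functional_extensionality => -[]. Qed.

Lemma run_reset r k w i d o : run_op (Reset r) (st k w i d o) =
  match r with
  | RK => st 0 w i d o | RW => st k 0 i d o
  | RI => st k w 0 d o | RD => st k w i 0 o
  end.
Proof. by rewrite st.unlock; case: r; congr Store; apply: functional_extensionality => -[]. Qed.

Lemma run_emit b k w i d o :
  run_op (Emit b) (st k w i d o) = st k w i d (o ++ [:: b]).
Proof. by rewrite st.unlock cats1. Qed.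

Lemma run_emit_word v k w i d o :
  run_ops (emit_word v) (st k w i d o) = st k w i d (o ++ v).
Proof.
rewrite emit_word.unlock; elim: v o => [|b v IH] o; first by rewrite cats0.
by rewrite [map _ _]/= run_ops_cons run_emit IH -catA.
Qed.

Definition addr_value (a : addr) (k w i d : nat) : nat :=
  foldr (fun r m => regfile k w i d r + m) a.2 a.1.

Lemma enc_natD m c : enc_nat (m + c) = nseq m true ++ enc_nat c.
Proof. by rewrite /enc_nat nseqD rcons_cat. Qed.

Lemma run_emit_addr a k w i d o :
  run_ops (emit_addr a) (st k w i d o)
  = st k w i d (o ++ enc_nat (addr_value a k w i d)).
Proof.
case: a => rs c; rewrite emit_addr.unlock run_ops_cat /=.
have -> : run_ops [seq EmitReg r | r <- rs] (st k w i d o)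
  = st k w i d (o ++ nseq (sumn (map (regfile k w i d) rs)) true).
  elim: rs o => [|r rs IH] o; first by rewrite cats0.
  rewrite [map _ _]/= run_ops_cons.
  have -> : run_op (EmitReg r) (st k w i d o)
      = st k w i d (o ++ nseq (regfile k w i d r) true) by rewrite st.unlock.
  by rewrite IH /= nseqD -catA.
rewrite run_emit_word -catA -enc_natD; congr (st _ _ _ _ (_ ++ enc_nat _)).
by rewrite /addr_value; elim: rs => //= r rs <-; rewrite addnA.
Qed.

Lemma run_emit_not a k w i d o :
  run_ops (emit_not a) (st k w i d o)
  = st k w i d (o ++ true :: enc_gate (Not (addr_value a k w i d))).
Proof. by rewrite emit_not.unlock run_ops_cat run_emit_word run_emit_addr -catA. Qed.

Lemma run_emit_and a a' k w i d o :
  run_ops (emit_and a a') (st k w i d o)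
  = st k w i d (o ++ true :: enc_gate (And (addr_value a k w i d) (addr_value a' k w i d))).
Proof. by rewrite emit_and.unlock run_ops_cat run_ops_cat run_emit_word !run_emit_addr -!catA. Qed.

Lemma run_emit_or a a' k w i d o :
  run_ops (emit_or a a') (st k w i d o)
  = st k w i d (o ++ true :: enc_gate (Or (addr_value a k w i d) (addr_value a' k w i d))).
Proof. by rewrite emit_or.unlock run_ops_cat run_ops_cat run_emit_word !run_emit_addr -!catA. Qed.


Definition run_opsE := (run_emit_not, run_emit_and, run_emit_or, run_emit_addr,
  run_emit_word, run_ops_cat, run_ops_cons, run_ops_nil, run_inc, run_reset, run_emit).

(** * Effect of the passes on the blocks of an instance *)

Notation enc_gates gs := (flatten [seq true :: enc_gate g | g <- gs]).
Notation enc_nats ns := (flatten [seq true :: enc_nat m | m <- ns]).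
Notation enc_bools bs := (flatten [seq true :: [:: b] | b <- bs]).

Lemma scan_cons (em : parser -> bool -> seq (op reg)) q b v s :
  scan parse em q (b :: v) s = scan parse em (parse q b) v (run_ops (em q b) s).
Proof. by []. Qed.

Lemma scan_number (em : parser -> bool -> seq (op reg)) q m v s :
  parse q true = q -> em q true = [::] ->
  scan parse em q (enc_nat m ++ v) s = scan parse em q (false :: v) s.
Proof.
move=> Eq Ee; elim: m => //= m IH.
by rewrite scan_cons Eq Ee.
Qed.

Lemma scan_ignored_gate (em : parser -> bool -> seq (op reg)) k g v s :
  (forall b, em (AtTag k) b = [::]) -> (forall t b, em (AtTag2 k t) b = [::]) ->
  (forall b, em (AtConst k) b = [::]) -> (forall b, em (InArg1 k) b = [::]) ->
  (forall b, em (InArg2 k) b = [::]) ->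
  scan parse em (AtTag k) (enc_gate g ++ v) s = scan parse em (AtGate k) v s.
Proof.
move=> H1 H2 H3 H4 H5.
case: g => [b|i|i j|i j]; rewrite [enc_gate _ ++ _]/= 2!scan_cons H1 H2 -?catA.
- by rewrite scan_cons H3.
- by rewrite scan_number // scan_cons H4.
- by rewrite scan_number // scan_cons H5 scan_number // scan_cons H4.
- by rewrite scan_number // scan_cons H5 scan_number // scan_cons H4.
Qed.

Lemma gates_pass_gate k g K W i d o v :
  let c := if k then K else 2 in
  scan parse gates_em (AtTag k) (enc_gate g ++ v) (st K W i d o)
  = scan parse gates_em (AtGate k) v (st K W i d (o ++ enc_gate (shift_gate c g))).
Proof.
have arg1 m v' o' : scan parse gates_em (InArg1 k) (enc_nat m ++ v') (st K W i d o')
    = scan parse gates_em (AtGate k) v' (st K W i d (o' ++ enc_nat (m + (if k then K else 2)))).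
  elim: m o' => [|m IH] o'.
    by rewrite scan_cons /= !run_opsE; case: (k); rewrite /addr_value /= ?addn0.
  by rewrite [enc_nat _ ++ _]/= scan_cons /= !run_opsE IH -catA.
have arg2 m v' o' : scan parse gates_em (InArg2 k) (enc_nat m ++ v') (st K W i d o')
    = scan parse gates_em (InArg1 k) v' (st K W i d (o' ++ enc_nat (m + (if k then K else 2)))).
  elim: m o' => [|m IH] o'.
    by rewrite scan_cons /= !run_opsE; case: (k); rewrite /addr_value /= ?addn0.
  by rewrite [enc_nat _ ++ _]/= scan_cons /= !run_opsE IH -catA.
move=> c; case: g => [b|m|m m'|m m'].
- by rewrite [enc_gate _ ++ _]/= !scan_cons /= !run_opsE -!catA.
- by rewrite [enc_gate _ ++ _]/= !scan_cons [parse _ _]/= /= !run_opsE arg1 -!catA.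
- by rewrite [enc_gate _ ++ _]/= -catA !scan_cons /= !run_opsE arg2 arg1 -!catA.
- by rewrite [enc_gate _ ++ _]/= -catA !scan_cons /= !run_opsE arg2 arg1 -!catA.
Qed.

Lemma gates_pass_gates k gs K W i d o v :
  let c := if k then K else 2 in
  scan parse gates_em (AtGate k) (enc_gates gs ++ v) (st K W i d o)
  = scan parse gates_em (AtGate k) v
      (st K W i d (o ++ enc_gates (map (shift_gate c) gs))).
Proof.
move=> c; elim: gs o => [|g gs IH] o; first by rewrite cats0.
rewrite [flatten _]/= cat_cons -catA scan_cons [parse _ _]/=.
have -> : gates_em (AtGate k) true = [:: Emit true] by case: (k).
rewrite !run_opsE gates_pass_gate IH.
by rewrite -!catA.
Qed.

Lemma gates_pass_digits k m K W i d o v :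
  scan parse gates_em (InOutput k) (enc_nat m ++ v) (st K W i d o)
  = scan parse gates_em (InOutput k) (false :: v) (st K W i (d + m) o).
Proof.
have E : gates_em (InOutput k) true = [:: Inc RD] by case: k.
elim: m d => [|m IH] d; first by rewrite addn0.
by rewrite [enc_nat _ ++ _]/= scan_cons E !run_opsE IH addSnnS.
Qed.

Lemma gates_pass_copies os K W i o v :
  scan parse gates_em (AtOutput false) (enc_nats os ++ v) (st K W i 0 o)
  = scan parse gates_em (AtOutput false) v
      (st K W i 0 (o ++ enc_gates (copy_gates 2 os))).
Proof.
elim: os o => [|m os IH] o; first by rewrite cats0.
rewrite [flatten _]/= cat_cons -catA scan_cons /= run_ops_nil gates_pass_digits.
rewrite scan_cons /= !run_opsE IH /addr_value /= !add0n.
by do 3!rewrite -?catA /=.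
Qed.

(** Between two outputs [RD] is 0, [RW] is the wire of the current flag and [RI] the index of the
    input bit to be compared next. *)
Lemma gates_pass_compare qs K W i o v :
  scan parse gates_em (AtOutput true) (enc_nats qs ++ v) (st K W i 0 o)
  = scan parse gates_em (AtOutput true) v
      (st K (W + 5 * size qs) (i + size qs) 0
        (o ++ enc_gates (compare_gates K W i qs))).
Proof.
elim: qs W i o => [|q qs IH] W i o; first by rewrite cats0 !addn0.
rewrite [flatten _]/= cat_cons -catA scan_cons /= run_ops_nil gates_pass_digits.
rewrite scan_cons /= !run_opsE /addr_value /= !addn0 add0n.
rewrite (_ : W.+1.+4 = W + 5); last by lia.
rewrite IH mulnS addnA addSnnS; congr (scan _ _ _ _ (st _ _ _ _ _)).
by do 6!rewrite -?catA /=.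
Qed.

(** [RW] stays at the sink flag, from which all addresses of selection gates are computed; only the
    index advances. *)
Lemma gates_pass_select bs K W i d o v :
  scan parse gates_em AtBit (enc_bools bs ++ v) (st K W i d o)
  = scan parse gates_em AtBit v
      (st K W (i + size bs) d (o ++ enc_gates (select_gates K W i (size bs)))).
Proof.
elim: bs i o => [|b bs IH] i o; first by rewrite cats0 !addn0.
rewrite -[_ ++ v]/(true :: b :: (enc_bools bs ++ v)) !scan_cons /= !run_opsE /addr_value /= !addn0.
rewrite IH addSnnS; congr (scan _ _ _ _ (st _ _ _ _ _)).
by do 4!rewrite -?catA /=.
Qed.

Lemma scan_ignored_nats (em : parser -> bool -> seq (op reg)) k ns v s :
  em (AtOutput k) true = [::] -> (forall b, em (InOutput k) b = [::]) ->
  scan parse em (AtOutput k) (enc_nats ns ++ v) s = scan parse em (AtOutput k) v s.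
Proof.
move=> H1 H2; have E : parse (AtOutput k) true = InOutput k by case: (k).
elim: ns => // m ns IH.
by rewrite [flatten _]/= cat_cons -catA scan_cons H1 E scan_number // scan_cons H2.
Qed.

Lemma count_pass_size m K W i d o v :
  scan parse count_em InSize (enc_nat m ++ v) (st K W i d o)
  = scan parse count_em (AtGate false) v (st (m + K) (2 * m + W) i d
      (o ++ enc_nat m ++ [:: false; true; false; false])).
Proof.
elim: m K W o => [|m IH] K W o.
  by rewrite [enc_nat _ ++ _]/= scan_cons /= !run_opsE.
rewrite [enc_nat _ ++ _]/= scan_cons /= !run_opsE IH -catA.
by congr (scan _ _ _ _ (st _ _ _ _ _)); lia.
Qed.

Lemma count_pass_gates k gs K W i d o v :
  scan parse count_em (AtGate k) (enc_gates gs ++ v) (st K W i d o)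
  = scan parse count_em (AtGate k) v
      (st (if k then K else size gs + K) (size gs + W) i d o).
Proof.
elim: gs K W => [|g gs IH] K W; first by case: k.
rewrite [flatten _]/= cat_cons -catA scan_cons [parse _ _]/= scan_ignored_gate //.
case: k IH => IH; rewrite /= !run_opsE IH.
  by rewrite addSnnS.
by rewrite !addSnnS.
Qed.

Lemma outputs_pass_size m K W i d o v :
  scan parse outputs_em InSize (enc_nat m ++ v) (st K W i d o)
  = scan parse outputs_em (AtGate false) v (st K W (m + i) d
      (o ++ enc_nats [seq W + (j + (j + (j + 8))) | j <- iota i m]
       ++ [:: false; true; true; false; true; false])).
Proof.
elim: m i o => [|m IH] i o.
  by rewrite [enc_nat _ ++ _]/= scan_cons /= !run_opsE.
rewrite [enc_nat _ ++ _]/= scan_cons /= !run_opsE IH addSnnS.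
by rewrite -!catA.
Qed.

Lemma outputs_pass_gates k gs v s :
  scan parse outputs_em (AtGate k) (enc_gates gs ++ v) s
  = scan parse outputs_em (AtGate k) v s.
Proof.
elim: gs => // g gs IH.
by rewrite [flatten _]/= cat_cons -catA scan_cons [parse _ _]/= scan_ignored_gate.
Qed.

Lemma outputs_pass_bits bs K W i d o v :
  scan parse outputs_em AtBit (enc_bools bs ++ v) (st K W i d o)
  = scan parse outputs_em AtBit v (st K W i d (o ++ enc_bools bs)).
Proof.
elim: bs o => [|b bs IH] o; first by rewrite cats0.
by rewrite -[_ ++ v]/(true :: b :: (enc_bools bs ++ v)) !scan_cons /= !run_opsE IH -!catA.
Qed.

Lemma enc_seqE (T : Type) (enc : T -> word) (s : seq T) :
  enc_seq enc s = flatten [seq true :: enc a | a <- s] ++ [:: false].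
Proof. by rewrite cats1. Qed.

Lemma enc_seq_bits1 bs :
  enc_seq enc_bits [:: bs] = true :: enc_bools bs ++ [:: false; false].
Proof. by rewrite enc_seqE [flatten _]/= cats0 /enc_bits enc_seqE /= -catA. Qed.

Lemma enc_sol_inputE (I : sol_input) :
  enc_sol_input I =
  enc_nat (sol_n I) ++ enc_gates (gates (sol_S I)) ++ false
  :: enc_nats (outputs (sol_S I)) ++ false :: enc_gates (gates (sol_P I)) ++ false
  :: enc_nats (outputs (sol_P I)) ++ false :: enc_bools (sol_s I) ++ [:: false].
Proof. by rewrite /enc_sol_input /enc_circuit /enc_bits !enc_seqE -!catA. Qed.

Lemma run_count_pass (I : sol_input) :
  run_pass parse InSize (enc_sol_input I) (Store (fun=> 0) [::])
    (emit_word [:: true; false; true] ++ [:: Inc RK; Inc RK; Inc RW; Inc RW], count_em)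
  = st (P_offset (sol_S I)) (first_flag (sol_S I) (sol_P I)) 0 0
      (enc_nat 1 ++ enc_nat (sol_n I).+1 ++ [:: false; true; false; false]).
Proof.
have -> : Store (fun=> 0) [::] = st 0 0 0 0 [::].
  by rewrite st.unlock; congr Store; apply: functional_extensionality => -[].
rewrite /run_pass [_.1]/= [_.2]/= !run_opsE enc_sol_inputE count_pass_size.
rewrite count_pass_gates scan_cons /= run_ops_nil scan_ignored_nats //.
rewrite scan_cons /= run_ops_nil count_pass_gates scan_cons /= run_ops_nil.
rewrite scan_ignored_nats // scan_cons /= run_ops_nil.
have skip_bits bs v s : scan parse count_em AtBit (enc_bools bs ++ v) s = scan parse count_em AtBit v s.
  by elim: bs.
rewrite skip_bits scan_cons /= run_ops_nil.
congr (st _ _ _ _ _) => //.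
  by rewrite /P_offset; lia.
by rewrite /first_flag /P_offset; lia.
Qed.

Lemma run_gates_pass (I : sol_input) o :
  let n := sol_n I in let S := sol_S I in let P := sol_P I in
  run_pass parse InSize (enc_sol_input I)
    (st (P_offset S) (first_flag S P) 0 0 o) ([::], gates_em)
  = st (P_offset S) (sink_flag S P) n 0 (o ++ enc_seq enc_gate (h_gates S P)).
Proof.
move=> n S P.
rewrite /run_pass [_.1]/= [_.2]/= run_ops_nil enc_sol_inputE.
have skip_size m v s : scan parse gates_em InSize (enc_nat m ++ v) s
    = scan parse gates_em (AtGate false) v s.
  by rewrite scan_number // scan_cons.
rewrite skip_size gates_pass_gates scan_cons /= run_ops_nil.
rewrite gates_pass_copies scan_cons /= run_ops_nil.
rewrite gates_pass_gates scan_cons /= !run_opsE.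
rewrite gates_pass_compare scan_cons /= !run_opsE.
rewrite gates_pass_select scan_cons /= !run_opsE.
rewrite !size_tuple; congr (st _ _ _ _ _).
rewrite enc_seqE /h_gates !map_cat !flatten_cat /= !add0n /addr_value /= !addn0.
by do 8!rewrite -?catA /=.
Qed.

Lemma run_outputs_pass (I : sol_input) o :
  let n := sol_n I in let S := sol_S I in let P := sol_P I in
  run_pass parse InSize (enc_sol_input I)
    (st (P_offset S) (sink_flag S P) n 0 o)
    (Reset RI :: Emit true :: emit_addr ([:: RW], 2), outputs_em)
  = st (P_offset S) (sink_flag S P) n 0 (o ++ enc_seq enc_nat (h_outputs S P)
      ++ enc_seq enc_bits [:: [:: false, false & sol_s I]]).
Proof.
move=> n S P.
rewrite (enc_seqE enc_nat) enc_seq_bits1.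
rewrite /run_pass [_.1]/= [_.2]/= run_ops_cons run_reset run_ops_cons run_emit.
rewrite run_emit_addr -catA enc_sol_inputE outputs_pass_size.
rewrite outputs_pass_gates scan_cons /= run_ops_nil scan_ignored_nats //.
rewrite scan_cons /= run_ops_nil outputs_pass_gates scan_cons /= run_ops_nil.
rewrite scan_ignored_nats // scan_cons /= run_ops_nil.
rewrite outputs_pass_bits scan_cons /= !run_opsE.
rewrite addn0; congr (st _ _ _ _ _).
rewrite /addr_value.
by do 8!rewrite -?catA /=.
Qed.

Lemma run_pigeon_passes (I : sol_input) :
  run_passes parse InSize pigeon_passes (enc_sol_input I)
  = enc_icp_input (pigeon_of I).
Proof.
rewrite /run_passes /pigeon_passes [foldl _ _ _]/= run_count_pass.
rewrite run_gates_pass run_outputs_pass st.unlock /=.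
rewrite /enc_icp_input /enc_circuit /=.
by do 8!rewrite -?catA /=.
Qed.

Theorem theorem23 : PPADS_hard InjectiveCategorizedPigeon.
Proof.
move=> R [f [g [polyf polyg red]]].
exists (fun x => run_passes parse InSize pigeon_passes (f x)), (fun x z => g x (half_drop2 z)).
split=> [||x xR]; [exact: polytime1_stream|exact: polytime2_half|].
have [[I fx] sol] := red x xR; rewrite fx run_pigeon_passes.
split=> [|z /pigeon_solution]; first by exists (pigeon_of I).
by rewrite -fx; exact: sol.
Qed.
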